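(* Let $S=\{\varphi_e:X_{t(e)}\to X_{i(e)}\}_{e\in E}$ be a conformal graph directed Markov system (CGDMS) with finite edge set $E$ and incidence matrix $A$. Then $$HD(J_{E,A})=\max\{HD(J_{C,A}) : C \text{ is a strongly connected component of } E\}.$$ In particular, $HD(J_{E,A})$ is the zero of the topological pressure function $P_{E,A}$.
   Context: GDMS. A graph directed Markov system consists of: a directed multigraph $(V,E,i,t)$ with finite vertex set $V$, countable edge set $E$ and maps $i,t:E\to V$ (initial and terminal vertex); an incidence matrix $A:E^2\to\{0,1\}$ such that $A_{ab}=1$ implies $t(a)=i(b)$; nonempty compact metric spaces $X_v$ ($v\in V$); a number $s\in(0,1)$; and for each $e\in E$ an injective map $\varphi_e:X_{t(e)}\to X_{i(e)}$ with Lipschitz constant at most $s$. Standing assumption: for every $a\in E$ there is $b\in E$ with $A_{ab}=1$. The GDMS is called finite if $E$ is finite. Words. $E_A^\infty=\{\omega\in E^{\mathbb N}: A_{\omega_i\omega_{i+1}}=1 \ \forall i\ge 1\}$; $E_A^*$ is the set of finite subwords of elements of $E_A^\infty$, called (finite) admissible words; $E_A^n$ is the set of those of length $n\ge 1$; $|\omega|$ is the length of $\omega$, and $\omega|_n=\omega_1\cdots\omega_n$. For $\omega=\omega_1\cdots\omega_n\in E_A^*$ put $t(\omega)=t(\omega_n)$ and $\varphi_\omega=\varphi_{\omega_1}\circ\cdots\circ\varphi_{\omega_n}:X_{t(\omega_n)}\to X_{i(\omega_1)}$. Limit set. For $\omega\in E_A^\infty$, $\pi(\omega)$ is the unique point of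 $\bigcap_{n\ge1}\varphi_{\omega|_n}(X_{t(\omega_n)})$, a point of the disjoint union $X$ of the $X_v$. The limit set is $J_{E,A}=\pi(E_A^\infty)$. For $F\subset E$, $J_{F,A}=\pi(E_A^\infty\cap F^{\mathbb N})$ is the limit set of the subsystem with edges $F$. $HD$ denotes Hausdorff dimension. Conformality. The GDMS is conformal (a CGDMS) if: (1) each $X_v$ is a compact connected subset of a common $\mathbb R^d$ and is the closure of its interior; (2) for all $a\ne b$ in $E$, $\varphi_a(\mathrm{Int}\,X_{t(a)})\cap\varphi_b(\mathrm{Int}\,X_{t(b)})=\emptyset$ (as subsets of the disjoint union $X$); (3) for each $v$ there is an open connected $W_v\supset X_v$ such that every $\varphi_e$ with $t(e)=v$ extends to a $C^1$ conformal diffeomorphism of $W_v$ into $W_{i(e)}$; (4) there are $l>0$ and $0<\gamma<\pi/2$ such that for each $v$ and each $x\in X_v$ there is an open cone with vertex $x$, central angle $\gamma$ and altitude $l$ contained in $\mathrm{Int}\,X_v$; (5) there are $L\ge1$, $\alpha>0$ with $\bigl||\varphi_e'(y)|-|\varphi_e'(x)|\bigr|\le L\,\|(\varphi_e')^{-1}\|^{-1}\|y-x\|^\alpha$ for all $e\in E$ and $x,y\in X_{t(e)}$. Here $|\varphi'(x)|$ is the norm of the derivative and $\|\varphi_\omega'\|$ (similarly $\|(\varphi_e')^{-1}\|$) is the supremum norm over $X_{t(\omega)}$. Strongly connected components. A set $C\subset E$ is a strongly connected component of $E$ if it is a maximal (with respect to inclusion) set of edges such that for any $c_1,c_2\in C$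 (possibly equal) there is a word $\omega$ with $c_1\omega c_2$ an admissible word all of whose letters lie in $C$. Pressure. $Z_{n,E,A}(u)=\sum_{\omega\in E_A^n}\|\varphi_\omega'\|^u$ for $u\ge0$, and $\theta_{E,A}=\inf\{u\ge 0: Z_{n,E,A}(u)<\infty \text{ for all but finitely many } n\}$. For $u>\theta_{E,A}$, and also for $u=\theta_{E,A}$ if $Z_{n,E,A}(\theta_{E,A})<\infty$ for all but finitely many $n$, $P_{E,A}(u)=\lim_{n\to\infty}\frac1n\ln Z_{n,E,A}(u)$; otherwise $P_{E,A}(u)=\infty$. *)

(* Defs.v *)
From mathcomp Require Import all_boot all_order all_algebra.
From mathcomp Require Import all_classical all_reals all_analysis.

Set Implicit Arguments.
Unset Strict Implicit.
Unset Printing Implicit Defensive.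

Import Order.TTheory GRing.Theory Num.Theory.
Import numFieldNormedType.Exports.

Local Open Scope classical_set_scope.
Local Open Scope ring_scope.

Definition is_max (R : realType) (A : set (\bar R)) (m : \bar R) : Prop :=
  A m /\ ubound A m.

(* The library norm on ['rV[R]_d] is the sup norm; it induces the usual
   topology and the usual notion of differential, but contraction ratios,
   derivative norms and conformality refer to the Euclidean structure. *)
Section euclidean.
Context {R : realType} {d : nat}.
Implicit Types (u x y : 'rV[R]_d) (M : 'M[R]_d).

Definition edot x y : R := \sum_j x ord0 j * y ord0 j.

Definition enorm x : R := Num.sqrt (edot x x).

(* Matrices act on row vectors from the right, as [jacobian] does. *)
Definition opnorm M : R := sup [set enorm (u *m M) | u in [set u | enorm u = 1]].

Definition similarity M : Prop :=
  exists2 c : R, 0 < c & forall u, enorm (u *m M) = c * enorm u.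

(* Axis direction u, full aperture gamma (so gamma / 2 around the axis),
   height l along the axis. *)
Definition open_cone x u (gamma l : R) : set 'rV[R]_d :=
  [set y | cos (gamma / 2) * enorm (y - x) < edot (y - x) u /\
           edot (y - x) u < l].

Definition C1_on (U : set 'rV[R]_d) (f : 'rV[R]_d -> 'rV[R]_d) : Prop :=
  forall x, U x -> differentiable f x /\ {for x, continuous (jacobian f)}.

Definition C1_diffeo_into (U U' : set 'rV[R]_d) (f : 'rV[R]_d -> 'rV[R]_d) :
    Prop :=
  [/\ C1_on U f, f @` U `<=` U', open (f @` U) &
      exists2 g, C1_on (f @` U) g & forall x, U x -> g (f x) = x].

Definition C1_conformal_diffeo (U U' : set 'rV[R]_d)
    (f : 'rV[R]_d -> 'rV[R]_d) : Prop :=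
  C1_diffeo_into U U' f /\ forall x, U x -> similarity (jacobian f x).

End euclidean.

Section hausdorff_dimension.
Context {R : realType} {T : Type} (dist : T -> T -> R).
Local Open Scope ereal_scope.

Definition diameter (U : set T) : \bar R :=
  ereal_sup [set (dist p.1 p.2)%:E | p in U `*` U].

(* diam(U)^u, where the empty set contributes 0 and, for u = 0, every nonempty
   set contributes 1. *)
Definition hausdorff_weight (u : R) (U : set T) : \bar R :=
  if `[< U !=set0 >] then (diameter U) `^ u else 0.

Definition hausdorff_premeasure (u delta : R) (A : set T) : \bar R :=
  ereal_inf [set \sum_(0 <= k <oo) hausdorff_weight u (U k) |
    U in [set U : nat -> set T |
      A `<=` \bigcup_k U k /\ forall k, diameter (U k) <= delta%:E]].

Definition hausdorff_measure (u : R) (A : set T) : \bar R :=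
  ereal_sup [set hausdorff_premeasure u delta A |
    delta in [set delta : R | (0 < delta)%R]].

Definition hausdorff_dim (A : set T) : \bar R :=
  ereal_inf [set u%:E | u in [set u : R | (0 <= u)%R /\
                                          hausdorff_measure u A = 0]].

End hausdorff_dimension.

(* [emap e] is a total function representing phi_e; in [gdms] only its
   restriction to X_{t(e)} matters. *)
Record gdms (R : realType) (d : nat) (V : finType) (E : countType) := Gdms {
  src : E -> V;
  tgt : E -> V;
  incid : rel E;
  incid_tgt_src : forall a b, incid a b -> tgt a = src b;
  incid_next : forall a, exists b, incid a b;
  space : V -> set 'rV[R]_d;
  space_nonempty : forall v, space v !=set0;
  space_compact : forall v, compact (space v);
  emap : E -> 'rV[R]_d -> 'rV[R]_d;
  emap_sub : forall e, emap e @` space (tgt e) `<=` space (src e);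
  emap_inj : forall e x y, space (tgt e) x -> space (tgt e) y ->
    emap e x = emap e y -> x = y;
  ratio : R;
  ratio_gt0 : 0 < ratio;
  ratio_lt1 : ratio < 1;
  emap_lipschitz : forall e x y, space (tgt e) x -> space (tgt e) y ->
    enorm (emap e x - emap e y) <= ratio * enorm (x - y)
}.

Section system.
Context {R : realType} {d : nat} {V : finType} {E : countType}.
Variable S : gdms R d V E.
Implicit Types (w : seq E) (omega : nat -> E) (F C : set E) (e : E).

(* Infinite words are indexed from 0: [omega n] is the letter omega_{n+1}. *)
Definition inf_admissible : set (nat -> E) :=
  [set omega | forall n, incid S (omega n) (omega n.+1)].

Definition admissible : set (seq E) :=
  [set w | exists2 omega, inf_admissible omega &
    exists k, w = mkseq (fun j => omega (k + j)%N) (size w)].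

Definition admissible_of_size (n : nat) : set (seq E) :=
  [set w | admissible w /\ size w = n].

Definition word_map w : 'rV[R]_d -> 'rV[R]_d :=
  foldr (fun e f => emap S e \o f) id w.

Definition word_dom w : set 'rV[R]_d :=
  if w is e :: w' then space S (tgt S (last e w')) else setT.

(* The disjoint union of the X_v sits in V * R^d, with the metric that is
   Euclidean on each component and puts distinct components at distance >= 1. *)
Definition union_dist (p q : V * 'rV[R]_d) : R :=
  enorm (p.2 - q.2) + (p.1 != q.1)%:R.

(* [get] selects the unique point of the nested intersection. *)
Definition coding_map omega : V * 'rV[R]_d :=
  (src S (omega 0%N),
   get (\bigcap_n (word_map (mkseq omega n.+1) @` space S (tgt S (omega n))))).

Definition limit_set F : set (V * 'rV[R]_d) :=
  coding_map @` [set omega | inf_admissible omega /\ forall n, F (omega n)].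

Definition HD (A : set (V * 'rV[R]_d)) : \bar R := hausdorff_dim union_dist A.

Definition strongly_connected C : Prop :=
  forall c1 c2, C c1 -> C c2 ->
    exists w, admissible (c1 :: rcons w c2) /\
      forall c, c \in c1 :: rcons w c2 -> C c.

Definition strongly_connected_component C : Prop :=
  strongly_connected C /\
  forall C', strongly_connected C' -> C `<=` C' -> C' = C.

(* In a conformal system [emap e] is taken to be the conformal extension of
   phi_e to W_{t(e)}; its derivative on X_{t(e)} does not depend on the
   extension because X_{t(e)} is the closure of its interior. *)
Definition dnorm w (x : 'rV[R]_d) : R := opnorm (jacobian (word_map w) x).

Definition dnorm_sup w : R := sup [set dnorm w x | x in word_dom w].

Definition dinv_sup e : R :=
  sup [set opnorm (invmx (jacobian (emap S e) x)) | x in space S (tgt S e)].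

Definition body_condition : Prop :=
  forall v, connected (space S v) /\ space S v = closure (interior (space S v)).

(* Images in different components of the disjoint union are disjoint, hence
   the premise [src S a = src S b]. *)
Definition open_set_condition : Prop :=
  forall a b, a != b -> src S a = src S b ->
    (emap S a @` interior (space S (tgt S a))) `&`
    (emap S b @` interior (space S (tgt S b))) = set0.

Definition extension_condition : Prop :=
  exists W : V -> set 'rV[R]_d,
    (forall v, [/\ open (W v), connected (W v) & space S v `<=` W v]) /\
    (forall e, C1_conformal_diffeo (W (tgt S e)) (W (src S e)) (emap S e)).

Definition cone_condition : Prop :=
  exists l gamma : R, [/\ 0 < l, 0 < gamma, gamma < pi / 2 &
    forall v x, space S v x ->
      exists2 u : 'rV[R]_d, enorm u = 1 &
        open_cone x u gamma l `<=` interior (space S v)].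

Definition holder_condition : Prop :=
  exists L alpha : R, [/\ 1 <= L, 0 < alpha &
    forall e x y, space S (tgt S e) x -> space S (tgt S e) y ->
      `| opnorm (jacobian (emap S e) y) - opnorm (jacobian (emap S e) x) |
        <= L * (dinv_sup e)^-1 * enorm (y - x) `^ alpha].

Definition conformal : Prop :=
  [/\ body_condition, open_set_condition, extension_condition,
      cone_condition & holder_condition].

Local Open Scope ereal_scope.

Definition Zsum (n : nat) (u : R) : \bar R :=
  \esum_(w in admissible_of_size n) (dnorm_sup w `^ u)%:E.

Definition Zsum_finite (u : R) : Prop := \forall n \near \oo, Zsum n u < +oo.

Definition theta : \bar R :=
  ereal_inf [set u%:E | u in [set u : R | (0 <= u)%R /\ Zsum_finite u]].

Definition log_growth (u : R) : nat -> \bar R :=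
  fun n => (n%:R^-1)%:E * lne (Zsum n u).

(* The limit exists in the first case, by submultiplicativity of [Zsum];
   requiring convergence keeps the default value of [lim], which is 0 in
   [\bar R], from being read as a zero of the pressure. *)
Definition pressure (u : R) : \bar R :=
  if `[< (theta < u%:E \/ (theta = u%:E /\ Zsum_finite u)) /\
         cvg (log_growth u @ \oo) >]
  then lim (log_growth u @ \oo) else +oo.

End system.

(* Main.v *)
From Pilot Require Import Defs.
From mathcomp Require Import all_boot all_order all_algebra.
From mathcomp Require Import all_classical all_reals all_analysis.
From mathcomp Require Import ring lra zify.
(* Imported again so that [space] denotes the field of [gdms]. *)
Import Pilot.Defs.
Set Implicit Arguments.
Unset Strict Implicit.
Unset Printing Implicit Defensive.
Import Order.TTheory GRing.Theory Num.Theory.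
Import numFieldNormedType.Exports.
Local Open Scope classical_set_scope.
Local Open Scope ring_scope.

(** An infinite admissible word over a finite alphabet visits some letter [a]
    infinitely often, and from the first such visit on it only uses letters of the
    strongly connected component of [a].  Hence the limit set is a countable union
    of Lipschitz images of limit sets of components, and countable stability of the
    Hausdorff dimension gives the first assertion
    ([hausdorff_null_components], [HD_limit_set_components]).

    For the second one, the partition functions [Z_n(u)] are submultiplicative in
    [n], so that the pressure [P(u)] exists by Fekete's lemma ([pressure_fekete]).
    Derivative norms of words of length [n] lie between [c ^ n] and [s ^ n] with
    [0 < c] and [s < 1]; therefore [P] is Lipschitz and strictly decreasing
    ([pressure_exponent]).  Writing [J] for the limit set and [H^u] for Hausdorff
    measure, it remains to see that [P(u) < 0] implies [H^u(J) = 0] and that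
    [P(u) > 0] implies [H^u(J) > 0].

    If [P(u) < 0], the images [phi_w(X)] of the words of length [n] cover [J], their
    diameters are at most a constant times the derivative norms
    ([word_map_diameter]), and [Z_n(u)] tends to [0] along a subsequence
    ([pressure_lt0_null]).

    If [P(u) > 0], then [Z_n(u)] is unbounded, and this alone yields an additive
    mass [m] on words with [m w <= N(w) ^ u], where [N(w)] is the derivative norm:
    take limits of the relative weights of prefixes among words of length [n],
    along those [n] at which [Z_n(u)] is the largest value so far
    ([submultiplicative_mass]).  Given a cover of [J] by sets [U_k] of size [r_k], stop
    each word that codes a point of [U_k] as soon as its derivative norm drops
    below [r_k].  By bounded distortion and the open set condition, boundedly many
    stopped words belong to each [U_k] ([stopped_multiplicity]), so that their
    total mass is at most a constant times the sum of the [r_k ^ u].  On the other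
    hand every infinite word is stopped, so that this mass is at least [1]
    ([stopped_mass_ge1]).  Hence the sums of the [r_k ^ u] are bounded below
    ([pressure_gt0_not_null]). *)

(** * Euclidean norm and packing *)

Section euclid.
Context {R : realType} {d : nat}.
Implicit Types (u x y z : 'rV[R]_d) (M : 'M[R]_d).

Lemma edotC x y : edot x y = edot y x.
Proof. by apply: eq_bigr => j _; rewrite mulrC. Qed.

Lemma edotDl x y z : edot (x + y) z = edot x z + edot y z.
Proof. by rewrite -big_split; apply: eq_bigr => j _; rewrite mxE mulrDl. Qed.

Lemma edotZl (a : R) x y : edot (a *: x) y = a * edot x y.
Proof. by rewrite /edot mulr_sumr; apply: eq_bigr => j _; rewrite mxE mulrA. Qed.

Lemma edotDr x y z : edot x (y + z) = edot x y + edot x z.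
Proof. by rewrite edotC edotDl !(edotC _ x). Qed.

Lemma edotZr (a : R) x y : edot x (a *: y) = a * edot x y.
Proof. by rewrite edotC edotZl edotC. Qed.

Lemma edot_ge0 x : 0 <= edot x x.
Proof. by apply: sumr_ge0 => j _; rewrite -expr2 sqr_ge0. Qed.

Lemma enorm_ge0 x : 0 <= enorm x.
Proof. exact: sqrtr_ge0. Qed.

Lemma enorm_sqr x : enorm x ^+ 2 = edot x x.
Proof. by rewrite sqr_sqrtr ?edot_ge0. Qed.

Lemma edot0_eq0 x : edot x x = 0 -> x = 0.
Proof.
move=> /eqP; rewrite psumr_eq0; last by move=> j _; rewrite -expr2 sqr_ge0.
move=> /allP h; apply/rowP => j; rewrite !mxE.
have := h j (mem_index_enum _); rewrite /= mulf_eq0 orbb.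
by move/eqP; rewrite [ord0]ord1.
Qed.

Lemma enorm_eq0 x : enorm x = 0 -> x = 0.
Proof.
by move=> h; apply: edot0_eq0; rewrite -enorm_sqr h expr0n.
Qed.

Lemma enormZ (a : R) x : enorm (a *: x) = `|a| * enorm x.
Proof.
by rewrite /enorm edotZl edotZr mulrA -expr2 sqrtrM ?sqr_ge0// sqrtr_sqr.
Qed.

Lemma enorm0 : enorm (0 : 'rV[R]_d) = 0.
Proof. by rewrite -(scale0r 0) enormZ normr0 mul0r. Qed.

Lemma enormN x : enorm (- x) = enorm x.
Proof. by rewrite -scaleN1r enormZ normrN1 mul1r. Qed.

Lemma enormB x y : enorm (x - y) = enorm (y - x).
Proof. by rewrite -enormN opprB. Qed.

(** The squared norm of [enorm y *: x - enorm x *: y] is nonnegative. *)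
Lemma cauchy_schwarz x y : edot x y <= enorm x * enorm y.
Proof.
have [x0|x0] := eqVneq (enorm x) 0.
  by rewrite (enorm_eq0 x0) enorm0 mul0r -(scale0r 0) edotZl mul0r.
have [y0|y0] := eqVneq (enorm y) 0.
  by rewrite (enorm_eq0 y0) enorm0 mulr0 -(scale0r 0) edotZr mul0r.
have xp : 0 < enorm x by rewrite lt_def x0 enorm_ge0.
have yp : 0 < enorm y by rewrite lt_def y0 enorm_ge0.
have := edot_ge0 (enorm y *: x + - enorm x *: y).
rewrite !(edotDl, edotDr, edotZl, edotZr) -!enorm_sqr (edotC y x) => h.
rewrite -(ler_pM2l (mulr_gt0 xp yp)); nra.
Qed.

Lemma enormD x y : enorm (x + y) <= enorm x + enorm y.
Proof.
have h : enorm (x + y) ^+ 2 <= (enorm x + enorm y) ^+ 2.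
  rewrite enorm_sqr !(edotDl, edotDr) (edotC y x) -!enorm_sqr.
  by have := cauchy_schwarz x y; nra.
by rewrite -(ler_pXn2r (_ : 0 < 2)%N) // nnegrE ?addr_ge0 ?enorm_ge0.
Qed.

Lemma enorm_triangle y x z : enorm (x - z) <= enorm (x - y) + enorm (y - z).
Proof.
have -> : x - z = (x - y) + (y - z) by rewrite addrA subrK.
exact: enormD.
Qed.

Lemma le_coord_enorm x j : `|x ord0 j| <= enorm x.
Proof.
rewrite -sqrtr_sqr; apply: ler_wsqrtr; rewrite /edot (bigD1 j)//= -expr2 lerDl.
by apply: sumr_ge0 => i _; rewrite -expr2 sqr_ge0.
Qed.

Lemma norm_le_enorm x : `|x| <= enorm x.
Proof.
rewrite [X in X <= _]mx_normrE; apply/bigmax_leP; split; first exact: enorm_ge0.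
by move=> [i j] _ /=; rewrite ord1; exact: le_coord_enorm.
Qed.

Lemma enorm_le_coord x (b : R) : 0 <= b ->
  (forall j, `|x ord0 j| <= b) -> enorm x <= d%:R * b.
Proof.
move=> b0 h.
have : enorm x ^+ 2 <= (d%:R * b) ^+ 2.
  rewrite enorm_sqr exprMn.
  apply: (@le_trans _ _ (\sum_(j < d) b ^+ 2)).
    apply: ler_sum => j _; rewrite -expr2 -real_normK ?num_real//.
    by rewrite ler_pXn2r ?nnegrE// ?h.
  rewrite sumr_const card_ord -[leLHS]mulr_natl; apply: ler_wpM2r; rewrite ?sqr_ge0//.
  rewrite -natrX ler_nat; nia.
by rewrite ler_pXn2r ?nnegrE ?mulr_ge0 ?enorm_ge0.
Qed.

Lemma enorm_le_norm x : enorm x <= d%:R * `|x|.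
Proof.
apply: enorm_le_coord => // j.
rewrite [leRHS]mx_normrE.
exact: (@le_bigmax _ _ _ _ (fun ij : 'I_1 * 'I_d => `|x ij.1 ij.2|) (ord0, j)).
Qed.

Lemma enorm_lip x y : `|enorm x - enorm y| <= enorm (x - y).
Proof.
rewrite ler_norml; have := enormD (x - y) y; have := enormD (y - x) x.
rewrite !subrK (enormB y x) => h1 h2; lra.
Qed.

(** The Euclidean norm lies between the sup norm and [d] times the sup norm. *)
Lemma nbhs_enormP x (A : set 'rV[R]_d) :
  nbhs x A <-> exists2 r, 0 < r & forall y, enorm (y - x) < r -> A y.
Proof.
split=> [/nbhs_ballP[r /= r0 h]|[r r0 h]].
  exists r => // y yr; apply: h; rewrite -ball_normE /= -normrN opprB.
  exact: le_lt_trans (norm_le_enorm _) yr.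
have d1 : 0 < d%:R + 1 :> R by rewrite ltr_wpDl.
apply/nbhs_ballP; exists (r / (d%:R + 1)) => /=; first by rewrite divr_gt0.
move=> y; rewrite -ball_normE /= -normrN opprB ltr_pdivlMr// => yr; apply: h.
apply: le_lt_trans (enorm_le_norm _) _; move: yr; rewrite mulrC mulrDl mul1r.
by have := normr_ge0 (y - x); lra.
Qed.

Lemma edist_continuous x : continuous (fun y => enorm (y - x)).
Proof.
move=> y A /nbhs_ballP[e /= e0 h]; apply/nbhs_enormP; exists e => // z zy.
apply: h; rewrite -ball_normE /= -normrN opprB.
by apply: le_lt_trans (enorm_lip _ _) _; rewrite opprB addrA subrK.
Qed.

Lemma closed_eball x (r : R) : closed [set y | enorm (y - x) <= r].
Proof.
apply: (@closed_comp _ _ (fun y => enorm (y - x)) [set t | t <= r]); last exact: closed_le.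
by move=> y _; exact: edist_continuous.
Qed.

(** Distinct points fall into distinct cells of a grid of mesh [r / (d + 1)], whose
    cells have diameter less than [r], and by scaling the number of cells that meet
    the ball does not depend on [r]. *)
Lemma packing_bound (K : R) : 0 <= K -> exists N : nat,
  forall (r : R) (z : 'rV[R]_d) (I : finType) (p : I -> 'rV[R]_d), 0 < r ->
    (forall i, enorm (p i - z) <= K * r) ->
    (forall i j, i != j -> r <= enorm (p i - p j)) -> (#|I| <= N)%N.
Proof.
move=> K0; pose h : R := d%:R + 1.
have h0 : 0 < h by rewrite /h ltr_wpDl.
pose m := (Num.truncn (2 * K * h)).+1.
exists #|{ffun 'I_d -> 'I_m}| => r z I p r0 pz psep.
pose co i (j : 'I_d) : R := (p i ord0 j - z ord0 j + K * r) / (r / h).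
have rh0 : 0 < r / h by rewrite divr_gt0.
have co0 i j : 0 <= co i j <= 2 * K * h.
  have := le_trans (le_coord_enorm (p i - z) j) (pz i).
  rewrite !mxE ler_norml => /andP[u1 u2].
  rewrite /co divr_ge0 ?ler_pdivrMr//=; last 2 first.
  - by move: u1; lra.
  - exact: ltW.
  have -> : 2 * K * h * (r / h) = 2 * K * r by field; rewrite gt_eqF.
  by lra.
have com i j : (Num.truncn (co i j) < m)%N.
  by have /andP[_ u] := co0 i j; rewrite ltnS; apply: le_truncn.
pose cell i : {ffun 'I_d -> 'I_m} := [ffun j => Ordinal (com i j)].
apply: (@leq_card _ _ cell) => i i' e; apply/eqP/negPn/negP => ni.
have := psep _ _ ni; apply/negP; rewrite -ltNge.
have e1 : enorm (p i - p i') <= d%:R * (r / h).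
  apply: enorm_le_coord => [|j]; first exact: ltW.
  have : Num.truncn (co i j) = Num.truncn (co i' j).
    by have /ffunP/(_ j) := e; rewrite !ffunE => -[].
  have /andP[a1 _] := co0 i j; have /andP[a2 _] := co0 i' j.
  have /andP[b1 b2] := truncn_itv a1; have /andP[b3 b4] := truncn_itv a2.
  move=> te; rewrite te in b1 b2; move: b1 b2 b3 b4; rewrite -natr1 => b1 b2 b3 b4.
  have : `|co i j - co i' j| <= 1 by rewrite ler_norml; lra.
  have -> : co i j - co i' j = (p i - p i') ord0 j / (r / h).
    by rewrite /co -mulrBl !mxE; congr (_ / _); ring.
  by rewrite normrM normfV (gtr0_norm rh0) ler_pdivrMr// mul1r.
apply: le_lt_trans e1 _; rewrite mulrA ltr_pdivrMr// mulrC ltr_pM2l//.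
by rewrite /h ltrDl.
Qed.

End euclid.

(** * Differentials, mean value estimates and images of balls *)

Section similarities.
Context {R : realType} {d : nat}.
Implicit Types (u x y : 'rV[R]_d) (M N : 'M[R]_d) (f g : 'rV[R]_d -> 'rV[R]_d).

Lemma exists_unit_enorm : (0 < d)%N -> exists u : 'rV[R]_d, enorm u = 1.
Proof.
move=> d0; exists (delta_mx ord0 (Ordinal d0)).
rewrite /enorm /edot (bigD1 (Ordinal d0))//= !mxE !eqxx mulr1 big1 ?addr0 ?sqrtr1//.
by move=> j /negPf jn; rewrite !mxE jn andbF mul0r.
Qed.

Lemma opnorm_ratio M (c : R) : (0 < d)%N ->
  (forall u, enorm (u *m M) = c * enorm u) -> opnorm M = c.
Proof.
move=> /exists_unit_enorm[u0 u01] h; rewrite /opnorm.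
suff -> : [set enorm (u *m M) | u in [set u | enorm u = 1]] = [set c] by rewrite sup1.
apply/seteqP; split => [_ [u /= u1 <-]|_ /= ->]; first by rewrite /= h u1 mulr1.
by exists u0; rewrite // h u01 mulr1.
Qed.

Lemma similarityE M : (0 < d)%N -> similarity M ->
  0 < opnorm M /\ forall u, enorm (u *m M) = opnorm M * enorm u.
Proof. by move=> d0 [c c0 h]; rewrite (opnorm_ratio d0 h). Qed.

Lemma similarityM M N : similarity M -> similarity N -> similarity (M *m N).
Proof.
move=> [a a0 ha] [b b0 hb]; exists (a * b); first exact: mulr_gt0.
by move=> u; rewrite mulmxA hb ha mulrA (mulrC b).
Qed.

Lemma similarity1 : similarity (1%:M : 'M[R]_d).
Proof. by exists 1 => // u; rewrite mulmx1 mul1r. Qed.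

Lemma opnormM M N : (0 < d)%N -> similarity M -> similarity N ->
  opnorm (M *m N) = opnorm M * opnorm N.
Proof.
move=> d0 sM sN; apply: opnorm_ratio => // u.
have [_ hM] := similarityE d0 sM; have [_ hN] := similarityE d0 sN.
by rewrite mulmxA hN hM mulrA (mulrC (opnorm N)).
Qed.

Lemma opnorm1 : (0 < d)%N -> opnorm (1%:M : 'M[R]_d) = 1.
Proof. by move=> d0; apply: opnorm_ratio => // u; rewrite mulmx1 mul1r. Qed.

Lemma mulmx_ext M N : (forall u, u *m M = u *m N) -> M = N.
Proof. by move=> h; apply/row_matrixP => i; rewrite !rowE h. Qed.

Lemma mulmx_jacobian f x u : u *m jacobian f x = 'd f x u.
Proof. by rewrite /jacobian mul_rV_lin1. Qed.

Lemma jacobian_comp f g x : differentiable f x -> differentiable g (f x) ->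
  jacobian (g \o f) x = jacobian f x *m jacobian g (f x) :> 'M[R]_d.
Proof.
move=> df dg; apply: mulmx_ext => u; rewrite mulmxA.
have dfg := @diff_comp _ _ _ _ f g x df dg.
have h1 := mulmx_jacobian (g \o f) x u.
have h2 := mulmx_jacobian f x u.
have h3 := mulmx_jacobian g (f x) ('d f x u).
transitivity ('d (g \o f) x u); first exact: h1.
transitivity ('d g (f x) ('d f x u)).
  exact: (f_equal (fun k : 'rV[R]_d -> 'rV[R]_d => k u) dfg).
by rewrite -h3 -h2.
Qed.

Lemma jacobian_id x : jacobian id x = 1%:M.
Proof.
apply: mulmx_ext => u; rewrite mulmx_jacobian mulmx1.
have h := @diff_lin R 'rV[R]_d 'rV[R]_d idfun x (fun (y : 'rV[R]_d) A => id).
exact: (f_equal (fun k : 'rV[R]_d -> 'rV[R]_d => k u) h).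
Qed.

Lemma differentiable_approx f x (eta : R) : differentiable f x -> 0 < eta ->
  exists2 r, 0 < r & forall y, enorm (y - x) < r ->
    enorm (f y - f x - (y - x) *m jacobian f x) <= eta * enorm (y - x).
Proof.
move=> /diff_locallyP[_ /eqaddoP h] eta0.
have d1 : 0 < d%:R + 1 :> R by rewrite ltr_wpDl.
have /h /nbhs_enormP[r r0 hr] : 0 < eta / (d%:R + 1) by rewrite divr_gt0.
exists r => // y yr; have := hr (y - x); rewrite subr0 => /(_ yr).
rewrite /= !fctE /= subrK opprD addrA => hh.
rewrite mulmx_jacobian.
apply: le_trans (enorm_le_norm _) _.
apply: (@le_trans _ _ ((d%:R + 1) * (eta / (d%:R + 1) * `|y - x|))).
  apply: ler_pM => //; first by rewrite lerDl.
rewrite mulrA (mulrC (d%:R + 1)) divfK ?gt_eqF// ler_pM2l//.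
exact: norm_le_enorm.
Qed.

Lemma differentiable_lipschitz_at f x (L eta : R) :
  differentiable f x -> (forall u, enorm (u *m jacobian f x) <= L * enorm u) ->
  0 < eta -> exists2 r, 0 < r & forall y, enorm (y - x) < r ->
    enorm (f y - f x) <= (L + eta) * enorm (y - x).
Proof.
move=> df hL eta0; have [r r0 hr] := differentiable_approx df eta0.
exists r => // y yr; have := hr y yr; have := hL (y - x).
have := enormD (f y - f x - (y - x) *m jacobian f x) ((y - x) *m jacobian f x).
by rewrite subrK mulrDl; lra.
Qed.

Lemma differentiable_expanding_at f x (l eta : R) :
  differentiable f x -> (forall u, l * enorm u <= enorm (u *m jacobian f x)) ->
  0 < eta -> exists2 r, 0 < r & forall y, enorm (y - x) < r ->
    (l - eta) * enorm (y - x) <= enorm (f y - f x).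
Proof.
move=> df hl eta0; have [r r0 hr] := differentiable_approx df eta0.
exists r => // y yr; have := hr y yr; have := hl (y - x).
have := enormD (f y - f x) (- (f y - f x - (y - x) *m jacobian f x)).
by rewrite enormN opprB addrC subrK mulrBl; lra.
Qed.

Definition segment x y (t : R) := x + t *: (y - x).

Lemma segmentB x y s t : segment x y s - segment x y t = (s - t) *: (y - x).
Proof. by rewrite /segment scalerBl opprD addrACA subrr add0r. Qed.

Lemma segment0 x y : segment x y 0 = x.
Proof. by rewrite /segment scale0r addr0. Qed.

Lemma segment1 x y : segment x y 1 = y.
Proof. by rewrite /segment scale1r addrC subrK. Qed.

(** Consider the supremum of the parameters in [[0, 1]] where [P] holds: by local
    propagation it is attained, and it cannot be smaller than [1]. *)
Lemma real_induction (P : R -> Prop) : P 0 ->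
  (forall t, 0 <= t <= 1 -> exists2 e, 0 < e & forall s s',
     0 <= s <= t -> t <= s' <= 1 -> t - e < s -> s' < t + e -> P s -> P s') ->
  P 1.
Proof.
move=> P0 hP; pose T := [set t | 0 <= t <= 1 /\ P t].
have T0 : T 0 by split; rewrite // lexx ler01.
have sT : has_sup T.
  by split; [exists 0|exists 1 => t [/andP[]]].
have t1 : sup T <= 1.
  by apply: sup_le_ub; [exists 0|move=> t [/andP[]]].
have t0 : 0 <= sup T by apply: ub_le_sup => //; case: sT.
have [|e e0 he] := hP (sup T); first by rewrite t0 t1.
have [s [/andP[s0 s1] Ps] se] := sup_adherent e0 sT.
have sle : s <= sup T by apply: ub_le_sup; [case: sT|split => //; rewrite s0 s1].
have [lt1|] := ltP 1 (sup T + e).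
  by apply: (he s 1) => //; rewrite ?s0 ?t1 ?lexx.
move=> h1; pose s' := sup T + e / 2.
have : T s'.
  split; first by rewrite /s'; apply/andP; split; lra.
  by apply: (he s) => //; rewrite ?s0 ?sle// /s'; try (apply/andP; split); lra.
by move=> /(ub_le_sup (proj2 sT)); rewrite /s'; lra.
Qed.

Lemma mean_value_enorm f x y (L : R) : 0 <= L ->
  (forall t : R, 0 <= t <= 1 -> differentiable f (segment x y t)) ->
  (forall (t : R) u, 0 <= t <= 1 ->
     enorm (u *m jacobian f (segment x y t)) <= L * enorm u) ->
  enorm (f y - f x) <= L * enorm (y - x).
Proof.
move=> L0 df hL; apply/ler_addgt0Pr => e e0.
have yx1 : 0 < enorm (y - x) + 1 by rewrite ltr_wpDl ?enorm_ge0.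
pose eta := e / (enorm (y - x) + 1); have eta0 : 0 < eta by rewrite divr_gt0.
pose P (t : R) : Prop := enorm (f (segment x y t) - f x) <= (L + eta) * (t * enorm (y - x)).
suff : P 1.
  rewrite /P segment1 mul1r => /le_trans; apply; rewrite mulrDl lerD2l.
  by rewrite /eta mulrAC ler_pdivrMr// ler_pM2l// lerDl.
apply: (@real_induction P); first by rewrite /P segment0 subrr enorm0 mul0r mulr0.
move=> t t01.
have [r r0 hr] := differentiable_lipschitz_at (df t t01) (fun u => hL t u t01) eta0.
have seg s : `|s - t| < r / (enorm (y - x) + 1) ->
    enorm (f (segment x y s) - f (segment x y t)) <= (L + eta) * (`|s - t| * enorm (y - x)).
  move=> st; rewrite -enormZ -segmentB; apply: hr.
  rewrite segmentB enormZ; move: st; rewrite ltr_pdivlMr// mulrDr mulr1.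
  by have := normr_ge0 (s - t); lra.
exists (r / (enorm (y - x) + 1)); first by rewrite divr_gt0.
move=> s s' /andP[s0 st] /andP[ts' s'1] se s'e Ps; rewrite /P.
have h1 : `|s - t| = t - s by rewrite ler0_norm; lra.
have h2 : `|s' - t| = s' - t by rewrite ger0_norm; lra.
have := seg s; have := seg s'; rewrite h1 h2 => /(_ ltac:(lra)) u1 /(_ ltac:(lra)) u2.
have := enorm_triangle (f (segment x y t)) (f (segment x y s')) (f x).
have := enorm_triangle (f (segment x y s)) (f (segment x y t)) (f x).
rewrite (enormB (f (segment x y t)) (f (segment x y s))).
move: Ps; rewrite /P; nra.
Qed.

(** The segment from [f x] to [z] is lifted step by step.  Lifts of the point of
    parameter [t] stay within distance
    [t * enorm (z - f x) / l < rho] of [x], so that by compactness the supremum of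
    the parameters with a lift also has one, and openness of [f] there would extend
    the lift further. *)
Lemma open_expanding_cover f x (rho l : R) : 0 < rho -> 0 < l ->
  (forall q : 'rV[R]_d, enorm (q - x) <= rho -> {for q, continuous f}) ->
  (forall q : 'rV[R]_d, enorm (q - x) < rho ->
     forall A, nbhs q A -> nbhs (f q) (f @` A)) ->
  (forall q : 'rV[R]_d, enorm (q - x) < rho -> exists2 r : R, 0 < r &
     forall q' : 'rV[R]_d, enorm (q' - q) < r -> l * enorm (q' - q) <= enorm (f q' - f q)) ->
  forall z : 'rV[R]_d, enorm (z - f x) < l * rho -> exists2 q, enorm (q - x) < rho & f q = z.
Proof.
move=> rho0 l0 fc fo fe z zr; pose v := enorm (z - f x) / l.
have v0 : 0 <= v by rewrite divr_ge0 ?enorm_ge0// ltW.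
have vr : v < rho by rewrite /v ltr_pdivrMr// mulrC.
pose P (t : R) := exists2 q : 'rV[R]_d, enorm (q - x) <= t * v & f q = segment (f x) z t.
suff [q qx fq] : P 1.
  exists q; first by rewrite (le_lt_trans qx)// mul1r.
  by rewrite fq segment1.
pose T := [set t | 0 <= t <= 1 /\ P t].
have T0 : T 0.
  split; rewrite ?lexx ?ler01//; exists x; rewrite ?segment0//.
  by rewrite subrr enorm0 mul0r.
have sT : has_sup T.
  by split; [exists 0|exists 1 => t [/andP[]]].
have t1 : sup T <= 1.
  by apply: sup_le_ub; [exists 0|move=> t [/andP[]]].
have t0 : 0 <= sup T by apply: ub_le_sup => //; case: sT.
set t := sup T in t1 t0.
have [q qx fq] : P t.
  pose Q (e : R) := [set q : 'rV[R]_d | exists s : R, [/\ 0 <= s <= t, t - e < s,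
    enorm (q - x) <= s * v & f q = segment (f x) z s]].
  pose F : set_system 'rV[R]_d := filter_from [set e | 0 < e] Q.
  have FF : ProperFilter F.
    apply: filter_from_proper; first apply: filter_from_filter.
    - by exists 1 => /=; exact: ltr01.
    - move=> e1 e2 /= h1 h2; exists (Num.min e1 e2) => /=; first by rewrite lt_min h1 h2.
      by move=> q [s [hs se qx fq]]; split; exists s; split => //;
        move: se; rewrite ltrBlDr -ltrBlDl lt_min => /andP[]; lra.
    - move=> e e0; have [s [/andP[s0 s1] [q qx fq]] se] := sup_adherent e0 sT.
      exists q, s; split => //; rewrite s0 /=.
      by apply: ub_le_sup; [case: sT|split; [rewrite s0 s1|exists q]].
  have cK : compact [set q | enorm (q - x) <= rho].
    apply: bounded_closed_compact; last exact: closed_eball.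
    exists (rho + `|x|); split; first exact: num_real.
    move=> m hm q /= qx; have := norm_le_enorm (q - x).
    have := ler_normD (q - x) x; rewrite subrK; lra.
  have FK : F [set q | enorm (q - x) <= rho].
    exists 1 => //= q [s [/andP[s0 st] _ qx _]]; apply: le_trans qx _; nra.
  have [q [/= qK cq]] := cK _ FF FK.
  have near_q (e : R) : 0 < e -> exists (q' : 'rV[R]_d) (s : R),
      [/\ 0 <= s <= t, t - e < s, enorm (q' - x) <= s * v & f q' = segment (f x) z s] /\
      (enorm (q' - q) < e /\ enorm (f q' - f q) < e).
    move=> e0.
    have FQ : F (Q e) by exists e.
    have nq : nbhs q ([set q' | enorm (q' - q) < e] `&` f @^-1` [set w | enorm (w - f q) < e]).
      apply: filterI; first by apply/nbhs_enormP; exists e.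
      by apply: fc => //; apply/nbhs_enormP; exists e.
    by have [q' [[s hs] qq']] := cq _ _ FQ nq; exists q', s.
  exists q.
    apply/ler_addgt0Pr => e e0.
    have [q' [s [[/andP[s0 st] se qx fq] [qq _]]]] := near_q e e0.
    have := enorm_triangle q' q x; rewrite (enormB q q'); nra.
  apply/eqP; rewrite -subr_eq0; apply/eqP/enorm_eq0/eqP.
  rewrite eq_le enorm_ge0 andbT; apply/ler_addgt0Pr => e e0; rewrite add0r.
  have w0 : 0 < 1 + enorm (z - f x) by rewrite ltr_pwDl ?enorm_ge0.
  have [|q' [s [[/andP[s0 st] se qx fq] [_ qq]]]] := near_q (e / (1 + enorm (z - f x))).
    by rewrite divr_gt0.
  have := enorm_triangle (f q') (f q) (segment (f x) z t).
  rewrite {2}fq segmentB enormZ (enormB (f q)) ler0_norm; last by lra.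
  have : e / (1 + enorm (z - f x)) * (1 + enorm (z - f x)) = e by rewrite divfK ?gt_eqF.
  rewrite (enormB (f q')) in qq.
  move: se qq; set w := e / _; have := enorm_ge0 (z - f x); nra.
have [t_ge1|t_lt1] := leP 1 t.
  by have -> : 1 = t; [apply/eqP; rewrite eq_le t_ge1 t1|exists q].
have tv : t * v < rho by apply: le_lt_trans vr; nra.
have qr := le_lt_trans qx tv.
have [r r0 hr] := fe q qr.
have nq : nbhs q [set q' | enorm (q' - q) < r] by apply/nbhs_enormP; exists r.
have /nbhs_enormP[e e0 he] := fo q qr _ nq.
have w0 : 0 < 1 + enorm (z - f x) by rewrite ltr_pwDl ?enorm_ge0.
have e'0 : 0 < e / (1 + enorm (z - f x)) by rewrite divr_gt0.
pose t' := Num.min 1 (t + e / (1 + enorm (z - f x)) / 2).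
have tt' : t < t' by rewrite lt_min t_lt1 /=; lra.
have t't : t' - t < e / (1 + enorm (z - f x)).
  by rewrite ltrBlDl gt_min; apply/orP; right; lra.
have ft' : enorm (segment (f x) z t' - f q) < e.
  rewrite fq segmentB enormZ gtr0_norm ?subr_gt0//.
  by move: t't; rewrite ltr_pdivlMr//; have := enorm_ge0 (z - f x); nra.
have [q' /= qq' fq'] := he _ ft'.
suff : T t' by move=> /(ub_le_sup (proj2 sT)); rewrite -/t; lra.
split; first by apply/andP; split; [lra|rewrite ge_min lexx].
exists q' => //; have := hr q' qq'; rewrite fq' fq segmentB enormZ gtr0_norm ?subr_gt0//.
have -> : (t' - t) * enorm (z - f x) = l * ((t' - t) * v) by rewrite /v; field; rewrite gt_eqF.
rewrite ler_pM2l// => h; have := enorm_triangle q q' x; lra.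
Qed.

End similarities.

(** * Hausdorff measure zero and dimension *)

Section hausdorff.
Context {R : realType} {T : Type} (dist : T -> T -> R).
Hypothesis dist0 : forall x, dist x x = 0.
Implicit Types (A B U : set T) (u t : R).
Local Open Scope ereal_scope.

Lemma hausdorff_weight_ge0 u U : 0 <= hausdorff_weight dist u U.
Proof. by rewrite /hausdorff_weight; case: ifP => // _; exact: poweR_ge0. Qed.

Lemma hausdorff_weight0 u : hausdorff_weight dist u set0 = 0.
Proof. by rewrite /hausdorff_weight; case: asboolP => // -[]. Qed.

Lemma diameter_ge0 U : U !=set0 -> 0 <= diameter dist U.
Proof.
move=> [x Ux]; apply: ereal_sup_ubound; exists (x, x) => //=.
by rewrite dist0.
Qed.

Lemma dist_le_diameter U x y : U x -> U y -> (dist x y)%:E <= diameter dist U.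
Proof. by move=> Ux Uy; apply: ereal_sup_ubound; exists (x, y). Qed.

Lemma diameter_le U (r : \bar R) :
  (forall x y, U x -> U y -> (dist x y)%:E <= r) -> diameter dist U <= r.
Proof. by move=> h; apply: ge_ereal_sup => _ [[x y] /= [Ux Uy] <-]; exact: h. Qed.

Lemma hausdorff_weight_le u U (r : R) : (0 <= u)%R -> (0 <= r)%R ->
  diameter dist U <= r%:E -> hausdorff_weight dist u U <= (r `^ u)%:E.
Proof.
move=> u0 r0 Ur; rewrite /hausdorff_weight; case: asboolP => U0; last first.
  by rewrite lee_fin powR_ge0.
rewrite -poweR_EFin; apply: gt0_ler_poweR => //; rewrite in_itv /= ?leey ?andbT//.
exact: diameter_ge0.
Qed.

Definition hausdorff_null u A := forall delta eps : R, (0 < delta)%R -> (0 < eps)%R ->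
  exists U : nat -> set T, [/\ A `<=` \bigcup_k U k,
    forall k, diameter dist (U k) <= delta%:E &
    \sum_(0 <= k <oo) hausdorff_weight dist u (U k) <= eps%:E].

Lemma hausdorff_nullP u A : hausdorff_measure dist u A = 0 <-> hausdorff_null u A.
Proof.
split=> [h delta eps d0 e0|h].
  have : hausdorff_premeasure dist u delta A < eps%:E.
    apply: (@le_lt_trans _ _ 0); last by rewrite lte_fin.
    by rewrite -h; apply: ereal_sup_ubound; exists delta.
  move=> /ereal_inf_lt[_ [U [/= AU Ud] <-] hU].
  by exists U; split => //; exact: ltW.
apply/eqP; rewrite eq_le; apply/andP; split.
  apply: ge_ereal_sup => _ [delta /= d0 <-]; apply/lee_addgt0Pr => e e0.
  rewrite add0e; have [U [AU Ud hU]] := h delta e d0 e0.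
  by apply: ereal_inf_le; exists (\sum_(0 <= k <oo) hausdorff_weight dist u (U k)) => //; exists U.
apply: (@le_trans _ _ (hausdorff_premeasure dist u 1 A)); last first.
  by apply: ereal_sup_ubound; exists 1%R => //=; rewrite ltr01.
apply: le_ereal_inf_tmp => _ [U _ <-]; apply: nneseries_ge0 => k _ _.
exact: hausdorff_weight_ge0.
Qed.

Lemma hausdorff_null_finite_cover (W : eqType) u A :
  (forall delta eps : R, (0 < delta)%R -> (0 < eps)%R ->
    exists (s : seq W) (U : W -> set T), [/\ forall x, A x -> exists2 w, w \in s & U w x,
      forall w, w \in s -> diameter dist (U w) <= delta%:E &
      \sum_(w <- s) hausdorff_weight dist u (U w) <= eps%:E]) ->
  hausdorff_null u A.
Proof.
move=> h delta eps d0 e0; have [s [U [AU Ud hU]]] := h delta eps d0 e0.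
have null_diam : diameter dist set0 <= delta%:E by apply: diameter_le => x y [].
case: s => [|w0 s] in AU Ud hU.
  exists (fun=> set0); split => // [x /AU[]//|].
  by rewrite eseries0 ?lee_fin ?ltW// => k _ _; exact: hausdorff_weight0.
pose U' k := if (k < size (w0 :: s))%N then U (nth w0 (w0 :: s) k) else set0.
exists U'; split => [x /AU[w ws Ux]|k|].
- exists (index w (w0 :: s)) => //; rewrite /U' index_mem ws nth_index//.
- by rewrite /U'; case: ifP => // ks; apply: Ud; exact: mem_nth.
rewrite (nneseries_split 0 (size (w0 :: s))); last by move=> k _; exact: hausdorff_weight_ge0.
rewrite add0n eseries0 => [|k ks _]; last by rewrite /U' ltnNge ks /= hausdorff_weight0.
rewrite adde0; apply: le_trans hU; rewrite (big_nth w0).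
by rewrite le_eqVlt; apply/orP; left; apply/eqP/eq_big_nat => k /andP[_ ks]; rewrite /U' ks.
Qed.

Lemma hausdorff_null_subset u A B : A `<=` B -> hausdorff_null u B -> hausdorff_null u A.
Proof.
move=> AB h delta eps d0 e0; have [U [BU Ud hU]] := h delta eps d0 e0.
by exists U; split => //; exact: subset_trans AB BU.
Qed.

Lemma hausdorff_null_exponent u t A : (0 <= u)%R -> (u <= t)%R ->
  hausdorff_null u A -> hausdorff_null t A.
Proof.
move=> u0 ut h delta eps d0 e0.
have [||U [BU Ud hU]] := h (Num.min delta 1%R) eps => //.
  by rewrite lt_min d0 ltr01.
exists U; split => // [k|]; first by apply: le_trans (Ud k) _; rewrite lee_fin ge_min lexx.
apply: le_trans hU; apply: lee_nneseries => [k _ _|k _].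
  exact: hausdorff_weight_ge0.
rewrite /hausdorff_weight; case: asboolP => // U0.
have := diameter_ge0 U0; have : diameter dist (U k) <= 1.
  by apply: le_trans (Ud k) _; rewrite lee_fin ge_min lexx orbT.
case: (diameter dist (U k)) => [r| |]//; rewrite !lee_fin => r1 r0.
move: r0; rewrite le_eqVlt => /predU1P[<-|r0].
  have [t0|tn0] := eqVneq t 0%R.
    by have -> : u = t by apply/eqP; rewrite eq_le ut t0 u0.
  by rewrite powR0// powR_ge0.
by apply: ger_powR; rewrite ?r0.
Qed.

Lemma hausdorff_null_bigcup u (A : nat -> set T) :
  (forall n, hausdorff_null u (A n)) -> hausdorff_null u (\bigcup_n A n).
Proof.
move=> h delta eps d0 e0.
have /choice[U hU] n : exists U : nat -> set T, [/\ A n `<=` \bigcup_k U k,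
    forall k, diameter dist (U k) <= delta%:E &
    \sum_(0 <= k <oo) hausdorff_weight dist u (U k) <= (eps / (2 ^ n.+1)%:R)%:E].
  by apply: h => //; rewrite divr_gt0// ltr0n expn_gt0.
have [f bij] : exists f : nat -> nat * nat, set_bij setT setT f.
  exact/card_set_bijP/card_esym/card_nat2.
exists (fun i => U (f i).1 (f i).2); split => [x [n _ Anx]|k|].
- have [/(_ _ Anx)[k _ Ux] _ _] := hU n.
  have [_ _ /(_ (n, k) I)[i _ fi]] := bij.
  by exists i => //; rewrite fi.
- by have [_ ->] := hU (f k).1.
rewrite nneseries_esumT; last by move=> k; exact: hausdorff_weight_ge0.
rewrite -(reindex_esum _ _ f (fun p => hausdorff_weight dist u (U p.1 p.2)) bij).
have -> : [set: nat * nat] = [set: nat] `*`` (fun=> [set: nat]) by apply/seteqP.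
rewrite -(@esum_esum _ _ _ _ _ (fun n k => hausdorff_weight dist u (U n k))); last first.
  by move=> *; exact: hausdorff_weight_ge0.
rewrite -nneseries_esumT; last by move=> n; apply: esum_ge0 => k _; exact: hausdorff_weight_ge0.
apply: (@le_trans _ _ (\sum_(0 <= n <oo) (0 + (eps / (2 ^ n.+1)%:R)%:E))).
  apply: lee_nneseries => [n _ _|n _]; first by apply: esum_ge0 => k _; exact: hausdorff_weight_ge0.
  rewrite add0e -nneseries_esumT; last by move=> k; exact: hausdorff_weight_ge0.
  by have [_ _ ->] := hU n.
apply: le_trans (epsilon_trick _ _ _) _ => //; first exact: ltW.
by rewrite eseries0// add0e.
Qed.

Lemma hausdorff_dim_le u A : (0 <= u)%R -> hausdorff_null u A -> hausdorff_dim dist A <= u%:E.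
Proof. by move=> u0 /hausdorff_nullP h; apply: ereal_inf_lbound; exists u. Qed.

Lemma hausdorff_dim_lt u A : hausdorff_dim dist A < u%:E -> hausdorff_null u A.
Proof.
move=> /ereal_inf_lt[_ [t [/= t0 /hausdorff_nullP h] <-]]; rewrite lte_fin => tu.
exact: hausdorff_null_exponent t0 (ltW tu) h.
Qed.

Lemma hausdorff_dim_ge0 A : 0 <= hausdorff_dim dist A.
Proof. by apply: le_ereal_inf_tmp => _ [t [/= t0 _] <-]; rewrite lee_fin. Qed.

Lemma hausdorff_dim_mono A B : A `<=` B -> hausdorff_dim dist A <= hausdorff_dim dist B.
Proof.
move=> AB; apply: le_ereal_inf => _ [t [/= t0 /hausdorff_nullP h] <-]; exists t => //.
by split => //; apply/hausdorff_nullP; exact: hausdorff_null_subset h.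
Qed.

Lemma hausdorff_dim_ge u A : ~ hausdorff_null u A -> u%:E <= hausdorff_dim dist A.
Proof. by move=> h; rewrite leNgt; apply/negP => /hausdorff_dim_lt. Qed.

(** Covering sets may reduce to points; positive radii give each of them a scale
    at which words can be stopped. *)
Lemma hausdorff_null_radii u A (eps : R) : (0 < u)%R -> (0 < eps)%R -> hausdorff_null u A ->
  exists (U : nat -> set T) (r : nat -> R), [/\ A `<=` \bigcup_k U k,
    forall k, (0 < r k)%R,
    forall k x y, U k x -> U k y -> (dist x y <= r k)%R &
    \sum_(0 <= k <oo) (r k `^ u)%:E <= eps%:E].
Proof.
move=> u0 e0 h; have [|U [AU Ud hU]] := h 1%R (eps / 2)%R ltr01; first by rewrite divr_gt0.
pose w k := hausdorff_weight dist u (U k).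
have w0 k : 0 <= w k by exact: hausdorff_weight_ge0.
have wfin k : w k \is a fin_num.
  rewrite ge0_fin_numE//; apply: (@le_lt_trans _ _ ((1 `^ u)%:E)); last exact: ltry.
  by apply: hausdorff_weight_le => //; exact: ltW.
pose r k := ((fine (w k) + (eps / 2) / (2 ^ k.+1)%:R) `^ u^-1)%R.
have p0 k : (0 < fine (w k) + (eps / 2) / (2 ^ k.+1)%:R)%R.
  rewrite ltr_wpDl ?fine_ge0// !divr_gt0// ltr0n expn_gt0//.
exists U, r; split => // [k|k x y Ux Uy|].
- by rewrite powR_gt0.
- have U0 : U k !=set0 by exists x.
  have := dist_le_diameter Ux Uy; have := diameter_ge0 U0.
  have := p0 k; rewrite /r; move: (Ud k); rewrite /w /hausdorff_weight; case: asboolP => // _.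
  case: (diameter dist (U k)) => [a| |]//; rewrite !lee_fin poweR_EFin/= => _ pp a0 xya.
  apply: le_trans xya _; have {1}-> : a = ((a `^ u) `^ u^-1)%R.
    by rewrite -powRrM divff ?gt_eqF// powRr1.
  apply: ge0_ler_powR; rewrite ?invr_ge0 ?nnegrE ?powR_ge0//; try exact: ltW.
  by rewrite lerDl !divr_ge0// ltW.
- apply: (@le_trans _ _ (\sum_(0 <= k <oo) (w k + ((eps / 2) / (2 ^ k.+1)%:R)%:E))).
    apply: lee_nneseries => [k _ _|k _]; first by rewrite lee_fin powR_ge0.
    rewrite /r -powRrM mulVf ?gt_eqF// powRr1 ?(ltW (p0 k))//.
    by rewrite EFinD fineK.
  apply: le_trans (epsilon_trick _ _ _) _ => //; first by rewrite divr_ge0// ltW.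
  have -> : eps%:E = (eps / 2)%:E + (eps / 2)%:E by rewrite -EFinD -splitr.
  by rewrite leeD2r.
Qed.

End hausdorff.

Section hausdorff_image.
Context {R : realType} {T : Type} (dist : T -> T -> R).
Hypothesis dist0 : forall x, dist x x = 0.
Local Open Scope ereal_scope.

Lemma hausdorff_null_image (u : R) (f : T -> T) (D A : set T) : (0 <= u)%R ->
  (forall x y, D x -> D y -> (dist (f x) (f y) <= dist x y)%R) ->
  hausdorff_null dist u A -> hausdorff_null dist u (f @` (A `&` D)).
Proof.
move=> u0 fl h delta eps d0 e0; have [U [AU Ud hU]] := h delta eps d0 e0.
have dU k : diameter dist (f @` (U k `&` D)) <= diameter dist (U k).
  apply: diameter_le => _ _ [x [Ux Dx] <-] [y [Uy Dy] <-].
  apply: (@le_trans _ _ (dist x y)%:E); first by rewrite lee_fin fl.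
  exact: dist_le_diameter.
exists (fun k => f @` (U k `&` D)); split => [_ [x [/AU[k _ Ux] Dx] <-]|k|].
- by exists k => //; exists x.
- exact: le_trans (dU k) (Ud k).
apply: le_trans hU; apply: lee_nneseries => [k _ _|k _].
  exact: hausdorff_weight_ge0.
rewrite {1}/hausdorff_weight; case: asboolP => [f0|_]; last exact: hausdorff_weight_ge0.
have U0 : U k !=set0 by have [_ [x [Ux _] _]] := f0; exists x.
rewrite /hausdorff_weight; case: asboolP => // _.
apply: gt0_ler_poweR => //; rewrite in_itv /= ?leey ?andbT//; exact: diameter_ge0.
Qed.

End hausdorff_image.

(** * Mass distributions on words *)

Section words.
Context {E : eqType} (es : seq E).

Definition words n : seq (seq E) :=
  iter n (fun L => [seq e :: w | e <- es, w <- L]) [:: [::]].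

Lemma mem_words n w : (w \in words n) = (size w == n) && all (mem es) w.
Proof.
elim: n w => [|n IH] [|e w] //=.
  by apply/negbTE/negP => /allpairsPdep[? [? []]].
rewrite eqSS andbCA -IH; apply/allpairsP/andP => [[[e' w'] /= [ee ww [-> ->]]]|[ee ww]] //.
by exists (e, w).
Qed.

Lemma words_uniq n : uniq es -> uniq (words n).
Proof.
move=> ues; elim: n => //= n IH; apply: allpairs_uniq => //.
by move=> [e1 w1] [e2 w2] _ _ /= [-> ->].
Qed.

Lemma sum_words0 (A : nmodType) (F : seq E -> A) :
  \sum_(w <- words 0) F w = F [::].
Proof. by rewrite big_seq1. Qed.

Lemma sum_words_cons (A : nmodType) (F : seq E -> A) n :
  \sum_(w <- words n.+1) F w = \sum_(e <- es) \sum_(w <- words n) F (e :: w).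
Proof. by rewrite [words _]/= big_allpairs_dep. Qed.

Lemma sum_words_cat (A : nmodType) (F : seq E -> A) m n :
  \sum_(w <- words (m + n)) F w =
  \sum_(v <- words m) \sum_(w <- words n) F (v ++ w).
Proof.
elim: m F => [|m IH] F; first by rewrite sum_words0 add0n.
by rewrite addSn !sum_words_cons; apply: eq_bigr => e _; rewrite IH.
Qed.

End words.

(** Along an ultrafilter, cluster points given by compactness are limits. *)
Lemma ultrafilter_limit (R : realType) (U : set_system nat) (f : nat -> R) (a b : R) :
  UltraFilter U -> U [set n | a <= f n <= b] ->
  exists2 l, a <= l <= b & f @ U --> l.
Proof.
move=> uU Uf.
have pU : ProperFilter U by exact: ultra_proper.
have fU : (f @ U) `[a, b]%classic.
  by apply: (@filterS _ U _ _ _ _ Uf) => n /= fn; rewrite in_itv.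
have [l [lab cl]] := @segment_compact R a b (f @ U) _ fU.
exists l => [|B nB]; first by move: lab; rewrite /= in_itv.
have [//|nBU] := in_ultra_setVsetC (f @^-1` B) uU.
have : (f @ U) (~` B) by [].
by move=> /cl/(_ nB)[x [] ].
Qed.

Section mass.
Context {R : realType} {E : choiceType} (es : seq E) (a : seq E -> R).
Hypothesis a_ge0 : forall w, 0 <= a w.
Hypothesis a_nil : a [::] = 1.
Hypothesis a_cat : forall v w, a (v ++ w) <= a v * a w.

Let Z n := \sum_(w <- words es n) a w.

(** The masses [m_n w], proportions of the total weight of words of length [n]
    that start with [w], are additive; along the lengths [n] at which [Z n] is a
    record, submultiplicativity bounds them by [a w * Z (n - size w) / Z n <= a w].
    Any limit inherits both properties. *)
Lemma submultiplicative_mass : (forall c, exists n, c < Z n) ->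
  exists m : seq E -> R, [/\ m [::] = 1,
    forall w, 0 <= m w <= a w &
    forall w, m w = \sum_(e <- es) m (rcons w e)].
Proof.
move=> Zub.
have Z0 n : 0 <= Z n by apply: sumr_ge0.
(* the lengths at which [Z] is a record; [rec_inf]: there are arbitrarily large ones *)
pose rec := [set n | forall j, (j <= n)%N -> Z j <= Z n].
have rec_inf N : exists2 n, rec n & (N <= n)%N.
  have [n0 hn0] := Zub (\sum_(j < N) Z j).
  pose n1 := [arg max_(i > (ord_max : 'I_n0.+1)) Z i]%O.
  have n1max (j : 'I_n0.+1) : Z j <= Z n1.
    by rewrite /n1; case: arg_maxP => // i _ h; exact: h.
  have n1N : (N <= n1)%N.
    rewrite leqNgt; apply/negP => n1N.
    have := n1max ord_max; apply/negP; rewrite -ltNge; apply: le_lt_trans hn0.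
    by rewrite (bigD1 (Ordinal n1N))//= lerDl; apply: sumr_ge0.
  exists n1 => // j jn1; apply: (n1max (Ordinal (leq_ltn_trans jn1 (ltn_ord n1)))).
pose F : set_system nat := filter_from setT (fun N => [set n | rec n /\ (N <= n)%N]).
have FF : ProperFilter F.
  apply: filter_from_proper; first apply: filter_from_filter.
  - by exists 0%N.
  - move=> i j _ _; exists (maxn i j) => // n [rn]; rewrite geq_max => /andP[hi hj].
    by split.
  - by move=> N _; have [n rn Nn] := rec_inf N; exists n.
(* an ultrafilter provides limits for all words at once *)
have [U [uU FU]] := ultraFilterLemma FF.
have U_rec N : U [set n | rec n /\ (N <= n)%N] by apply: FU; exists N.
pose S n w := \sum_(v <- words es (n - size w)) a (w ++ v).
have S_le n w : S n w <= a w * Z (n - size w).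
  by rewrite /S /Z mulr_sumr; apply: ler_sum.
have Zp n : rec n -> 0 < Z n.
  move=> /(_ 0%N (leq0n n)); rewrite {1}/Z sum_words0 a_nil; exact: lt_le_trans.
have Sb w : U [set n | 0 <= S n w / Z n <= a w].
  apply: filterS (U_rec (size w)) => n [rn wn] /=.
  rewrite divr_ge0 ?sumr_ge0//= ler_pdivrMr ?Zp//.
  apply: le_trans (S_le n w) _; apply: ler_wpM2l => //; apply: rn; exact: leq_subr.
have /choice[m hm] w : exists l, 0 <= l <= a w /\ (fun n => S n w / Z n) @ U --> l.
  by have [l] := ultrafilter_limit uU (Sb w); exists l.
have U_proper : ProperFilter U by exact: ultra_proper.
exists m; split => [|w|w]; last 2 first.
- by have [] := hm w.
- have [_ cw] := hm w.
  have cs : (fun n => \sum_(e <- es) (S n (rcons w e) / Z n)) @ U -->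
      \sum_(e <- es) m (rcons w e).
    elim: es => [|e s IH].
      rewrite big_nil (_ : (fun _ => _) = fun=> 0); first exact: cvg_cst.
      by apply/funext => n; rewrite big_nil.
    rewrite big_cons (_ : (fun _ => _) = (fun n => S n (rcons w e) / Z n) \+
      (fun n => \sum_(e <- s) (S n (rcons w e) / Z n))).
      by apply: cvgD => //; have [] := hm (rcons w e).
    by apply/funext => n; rewrite big_cons.
  apply: (cvg_unique _ cw); first exact: Rhausdorff.
  apply: cvg_trans cs; apply: near_eq_cvg.
  apply: filterS (U_rec (size w).+1) => n [rn wn] /=.
  rewrite -mulr_suml; congr (_ / _); rewrite /S.
  have -> : (n - size w)%N = (n - (size w).+1).+1 by rewrite subnSK.
  rewrite sum_words_cons; apply: eq_bigr => e _; rewrite size_rcons.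
  by apply: eq_bigr => v _; rewrite cat_rcons.
have [_ c] := hm [::].
apply: (cvg_unique _ c); first exact: Rhausdorff.
apply: (@cvg_trans _ ((fun=> 1 : R) @ U)); last exact: cvg_cst.
apply: near_eq_cvg.
apply: filterS (U_rec 0%N) => n [rn _] /=.
by rewrite /S subn0 divff// gt_eqF// Zp.
Qed.

(** If the stopped words [G] had total mass below [1], then following at each
    node a child whose stopped descendants have less than its mass would produce
    an infinite word that is never stopped. *)
Lemma stopped_mass_ge1 (m : seq E -> R) (G : set (seq E)) :
  uniq es -> m [::] = 1 -> (forall w, 0 <= m w) ->
  (forall w, m w = \sum_(e <- es) m (rcons w e)) ->
  (forall omega : nat -> E, (forall n, 0 < m (mkseq omega n)) ->
     exists n, G (mkseq omega n)) ->
  (1 <= \esum_(w in G) (m w)%:E)%E.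
Proof.
move=> ues m_nil m0 madd hG; rewrite leNgt; apply/negP => lt1.
(* the total mass of the stopped descendants of [w] *)
pose D w := (\esum_(v in G) (m v * (prefix w v)%:R)%:E)%E.
have D0 v w : (0 <= (m v * (prefix w v)%:R)%:E)%E by rewrite lee_fin mulr_ge0.
have D_mem w : G w -> ((m w)%:E <= D w)%E.
  move=> Gw; apply: esum_ge; exists [set w]; last first.
    by rewrite fsbig_set1 prefix_refl mulr1.
  by split => // v ->.
have D_children w : (D w < (m w)%:E)%E ->
    exists2 e, e \in es & (D (rcons w e) < (m (rcons w e))%:E)%E.
  move=> Dw; apply: contrapT => nex; move: Dw; apply/negP; rewrite -leNgt.
  have [Gw|nGw] := pselect (G w); first exact: D_mem.
  apply: (@le_trans _ _ (\sum_(e <- es) D (rcons w e))%E).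
    rewrite madd -sumEFin; rewrite big_seq [leRHS]big_seq; apply: lee_sum => e ees.
    by rewrite leNgt; apply/negP => h; apply: nex; exists e.
  rewrite /D -esum_sum//; apply: le_esum => v Gv.
  rewrite sumEFin lee_fin -mulr_sumr; apply: ler_wpM2l => //.
  have [/prefixP[t vt]|nwv] := boolP (prefix w v); last first.
    rewrite big1// => e _; case: (boolP (prefix (rcons w e) v)) => // /prefixP[t vt].
    by move: nwv; rewrite vt cat_rcons prefix_prefix.
  case: t vt => [|e t] vt; first by rewrite cats0 in vt; case: nGw; rewrite -vt.
  have pe e' : prefix (rcons w e') v = (e' == e).
    apply/prefixP/eqP => [[t']|->]; last by exists t; rewrite cat_rcons.
    by rewrite vt cat_rcons => /eqP; rewrite eqseq_cat// eqxx /= => /eqP[].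
  under eq_bigr => e' _ do rewrite pe.
  rewrite -natr_sum ler_nat.
  have -> : (\sum_(e' <- es) (e' == e) = count_mem e es)%N.
    by elim: (es) => [|e' s IH]; rewrite ?big_nil ?big_cons//= IH.
  by rewrite count_uniq_mem// leq_b1.
have [e0 _ _] : exists2 e, e \in es & (D (rcons [::] e) < (m (rcons [::] e))%:E)%E.
  apply: D_children; rewrite m_nil; apply: le_lt_trans lt1.
  by apply: le_esum => w _; rewrite prefix0s mulr1.
pose good w := (D w < (m w)%:E)%E.
have /choice[next hnext] w : exists e, good w -> good (rcons w e).
  have [gw|ngw] := pselect (good w); last by exists e0 => /ngw.
  by have [e _ ge] := D_children w gw; exists e.
pose path_ n := iter n (fun w => rcons w (next w)) [::].
pose omega n := next (path_ n).
have pathE n : path_ n = mkseq omega n.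
  by elim: n => // n IH; rewrite -[LHS]/(rcons (path_ n) (omega n)) IH mkseqS.
have good_path n : good (path_ n).
  elim: n => [|n IH]; last exact: hnext.
  rewrite /good m_nil; apply: le_lt_trans lt1.
  by apply: le_esum => w _; rewrite prefix0s mulr1.
have [n|n] := hG omega.
  rewrite -pathE -lte_fin; apply: le_lt_trans (good_path n).
  exact: esum_ge0.
by rewrite -pathE => /D_mem; apply/negP; rewrite -ltNge; exact: good_path.
Qed.

End mass.

(** Fekete's lemma: for [k] with [a k / k] close to the infimum [l] and
    [n = q * k + j] with [j < k], subadditivity gives [a n <= q * a k + a j], and the
    terms [a j] are bounded. *)
Lemma subadditive_cvg (R : realType) (a : nat -> R) (b : R) :
  (forall m n, a (m + n)%N <= a m + a n) -> (forall n, - b * n%:R <= a n) ->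
  exists l : R, [/\ (fun n => a n / n%:R) @ \oo --> l,
    forall n, l * n%:R <= a n &
    forall c, l < c -> exists2 n, (0 < n)%N & a n < c * n%:R].
Proof.
move=> suba lba.
pose T := [set a n / n%:R | n in [set n | (0 < n)%N]].
have T0 : T !=set0 by exists (a 1%N / 1%:R), 1%N.
have Tlb : has_lbound T.
  exists (- b) => _ [n /= n0 <-]; rewrite ler_pdivlMr ?ltr0n//.
have hT : has_inf T by split.
have l_le n : inf T * n%:R <= a n.
  case: n => [|n]; first by rewrite mulr0; have := lba 0%N; rewrite mulr0.
  by rewrite -ler_pdivlMr ?ltr0n//; apply: ge_inf => //; exists n.+1.
have lt_l c : inf T < c -> exists2 n, (0 < n)%N & a n < c * n%:R.
  move=> lc; have ec : 0 < c - inf T by rewrite subr_gt0.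
  have [_ [n /= n0 <-]] := inf_adherent ec hT; rewrite addrC subrK.
  by rewrite ltr_pdivrMr ?ltr0n//; exists n.
exists (inf T); split => //.
apply/cvgrPdist_lt => e e0.
have [k k0 hk] := lt_l (inf T + e / 2) ltac:(lra).
have amul q : a (q * k)%N <= q%:R * a k + `|a 0%N|.
  elim: q => [|q IH]; first by rewrite !mul0n mul0r add0r ler_norm.
  rewrite mulSn; apply: le_trans (suba _ _) _; rewrite -natr1; lra.
pose C := `|a 0%N| + \sum_(j < k) `|a j| + `|inf T + e / 2| * k%:R.
have C0 : 0 <= C by rewrite !addr_ge0 ?mulr_ge0 ?sumr_ge0.
near=> n.
have n0 : (0 < n)%N by near: n; exists 1%N.
have Cn : C < e / 2 * n%:R.
  rewrite mulrC -ltr_pdivrMr//; last by lra.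
  by near: n; exact: nbhs_infty_gtr.
have an : a n <= (inf T + e / 2) * n%:R + C.
  rewrite {1}(divn_eq n k); apply: le_trans (suba _ _) _.
  have jk : (n %% k < k)%N by rewrite ltn_mod.
  have h1 : a (n %% k)%N <= \sum_(j < k) `|a j|.
    rewrite (bigD1 (Ordinal jk))//=; apply: le_trans (ler_norm _) _.
    by rewrite lerDl sumr_ge0.
  have h2 := amul (n %/ k)%N.
  have nE : n%:R = (n %/ k)%:R * k%:R + (n %% k)%:R :> R by rewrite -natrM -natrD -divn_eq.
  have h3 : (n %/ k)%:R * a k <= (n %/ k)%:R * ((inf T + e / 2) * k%:R).
    by apply: ler_wpM2l => //; exact: ltW.
  have h4 : - (`|inf T + e / 2| * k%:R) <= (inf T + e / 2) * (n %% k)%:R.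
    apply: (@le_trans _ _ (- (`|inf T + e / 2| * (n %% k)%:R))).
      by rewrite lerN2; apply: ler_wpM2l => //; rewrite ler_nat ltnW.
    by rewrite -mulNr; apply: ler_wpM2r => //; rewrite lerNl -normrN ler_norm.
  rewrite /C nE; lra.
have n0' : 0 < n%:R :> R by rewrite ltr0n.
rewrite ltr_distlC; apply/andP; split.
  by rewrite ltr_pdivlMr//; have := l_le n; nra.
rewrite ltr_pdivrMr//; nra.
Unshelve. all: by end_near. Qed.

Lemma esum_bigcup_le (R : realType) (T : choiceType) (a : T -> \bar R) (G : nat -> set T) :
  (forall x, 0 <= a x)%E ->
  (\esum_(x in \bigcup_k G k) a x <= \sum_(0 <= k <oo) \esum_(x in G k) a x)%E.
Proof.
move=> a0; have /choice[idx hidx] x : exists k, (\bigcup_k G k) x -> G k x.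
  have [[k _ Gk]|nG] := pselect ((\bigcup_k G k) x); first by exists k.
  by exists 0%N => /nG.
pose J k := [set x | (\bigcup_k G k) x /\ idx x = k].
have -> : \bigcup_k G k = \bigcup_(k in setT) J k.
  by apply/seteqP; split => x; [move=> Gx; exists (idx x)|case=> k _ []].
rewrite esum_bigcupT//; last by move=> i j _ _ [x [[_ <-] [_ <-]]].
rewrite -nneseries_esumT; last by move=> k; exact: esum_ge0.
apply: lee_nneseries => [k _ _|k _]; first exact: esum_ge0.
apply: le_ereal_sup => _ [X [Xfin XJ] <-]; exists X => //; split => // x /XJ[Gx <-].
exact: hidx.
Qed.

Lemma esum_le_card (R : realType) (T : choiceType) (a : T -> \bar R) (G : set T)
    (b : R) (M : nat) : 0 <= b -> (forall x, G x -> (a x <= b%:E)%E) ->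
  (forall s : seq T, uniq s -> (forall x, x \in s -> G x) -> (size s <= M)%N) ->
  (\esum_(x in G) a x <= (M%:R * b)%:E)%E.
Proof.
move=> b0 ab hM; apply: ge_ereal_sup => _ [X [/finite_seqP[s Xs] XG] <-].
have {}Xs : X = [set` undup s] by rewrite Xs; apply/seteqP; split => x /=; rewrite mem_undup.
have us := undup_uniq s; move: (undup s) us Xs => {}s us Xs.
have sG x : x \in s -> G x by move=> xs; apply: XG; rewrite Xs.
rewrite Xs -fsbig_seq//; apply: (@le_trans _ _ (\sum_(x <- s) b%:E)%E).
  by rewrite big_seq [leRHS]big_seq; apply: lee_sum => x /sG; exact: ab.
rewrite sumEFin lee_fin big_const_seq count_predT iter_addr_0 -[leLHS]mulr_natl.
by apply: ler_wpM2r => //; rewrite ler_nat; exact: hM.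
Qed.

(** * Conformal maps of the system *)

Lemma finite_uniform_bound (R : realType) (E : choiceType) (P : E -> R -> Prop) :
  finite_set [set: E] -> (forall e b b', b <= b' -> P e b -> P e b') ->
  (forall e, exists b, P e b) -> exists b, forall e, P e b.
Proof.
move=> /finite_seqP[es Ees] mono hP.
have ees e : e \in es by have := I : [set: E] e; rewrite Ees.
suff [b hb] : exists b, forall e, e \in es -> P e b by exists b => e; exact: hb.
elim: es {Ees ees} => [|e es [b hb]]; first by exists 0.
have [b' hb'] := hP e; exists (Num.max b b') => e'; rewrite inE => /predU1P[->|/hb].
  by apply: mono hb'; rewrite le_max lexx orbT.
by apply: mono; rewrite le_max lexx.
Qed.

Lemma powR_exprM (R : realType) (s D alpha : R) n : 0 <= s -> 0 <= D ->
  (s ^+ n * D) `^ alpha = (s `^ alpha) ^+ n * D `^ alpha.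
Proof.
move=> s0 D0; rewrite powRM ?exprn_ge0//; congr (_ * _).
rewrite -(powR_mulrn n s0) -(powR_mulrn n (powR_ge0 s alpha)).
by rewrite -(powRrM s) mulrC (powRrM s).
Qed.

Lemma cos_half_aperture (R : realType) (gamma : R) : 0 < gamma -> gamma < pi / 2 ->
  0 < cos (gamma / 2) < 1.
Proof.
move=> g0 gpi; apply/andP; split.
  by apply: cos_gt0_pihalf; lra.
by rewrite -[ltRHS](@cos0 R) ltr_cos ?in_itv/=; [|apply/andP; split..]; lra.
Qed.

Lemma compact_min (R : realType) (d : nat) (f : 'rV[R]_d -> R) (A : set 'rV[R]_d) :
  A !=set0 -> compact A -> (forall x, A x -> f @ within A (nbhs x) --> f x) ->
  exists2 z, A z & forall x, A x -> f z <= f x.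
Proof.
move=> A0 cA /subspace_continuousP cf; have [z zA hz] := EVT_min_rV A0 cA cf.
exists z => [|x Ax]; first by move: zA; rewrite inE.
by apply: hz; rewrite inE.
Qed.

Section conformal_maps.
Context {R : realType} {d : nat} {V : finType} {E : countType}.
Variable S : gdms R d V E.
Hypothesis confS : conformal S.
Implicit Types (e : E) (w v : seq E) (x y : 'rV[R]_d).

Lemma conformal_dim_gt0 : [set: E] !=set0 -> (0 < d)%N.
Proof.
move=> [e _]; have [_ _ _ [l [gamma [_ _ _ h]]] _] := confS.
have [x Xx] := space_nonempty S (tgt S e); have [u] := h _ _ Xx.
rewrite lt0n => u1 _; apply/eqP => d0; move: u1.
suff -> : enorm u = 0 by move=> /esym/eqP; rewrite oner_eq0.
by rewrite /enorm /edot big1 ?sqrtr0// => -[j jd]; exfalso; rewrite d0 in jd.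
Qed.

Lemma emap_differentiable e x : space S (tgt S e) x -> differentiable (emap S e) x.
Proof.
have [_ _ [W [hW hf]] _ _] := confS.
have [_ _ XW] := hW (tgt S e); have [[C1f _ _ _] _] := hf e.
by move=> /XW /C1f[].
Qed.

Lemma emap_similarity e x : space S (tgt S e) x -> similarity (jacobian (emap S e) x).
Proof.
have [_ _ [W [hW hf]] _ _] := confS.
have [_ _ XW] := hW (tgt S e); have [_ sim] := hf e.
by move=> /XW /sim.
Qed.

(** Conformal diffeomorphisms are open maps, by continuity of the inverse. *)
Lemma emap_open e x A : space S (tgt S e) x -> nbhs x A ->
  nbhs (emap S e x) (emap S e @` A).
Proof.
have [_ _ [W [hW hf]] _ _] := confS.
have [oW _ XW] := hW (tgt S e); have [[_ _ ofW [g C1g gK]] _] := hf e.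
move=> /XW Wx nA.
have fWx : (emap S e @` W (tgt S e)) (emap S e x) by exists x.
have cg : {for emap S e x, continuous g}.
  by apply: differentiable_continuous; have [] := C1g _ fWx.
have nfW : nbhs (emap S e x) (emap S e @` W (tgt S e)) by exact: open_nbhs_nbhs.
have ng : nbhs (emap S e x) (g @^-1` A) by apply: cg; rewrite gK.
apply: filterS (filterI nfW ng) => _ [[y Wy <-]]; rewrite /= gK// => Ay.
by exists y.
Qed.

(** Stretching along a direction that stays inside the space, as provided by the
    cone condition, is bounded by the Lipschitz constant; by conformality so is
    stretching in every other direction. *)
Lemma opnorm_emap_le e x : space S (tgt S e) x ->
  opnorm (jacobian (emap S e) x) <= ratio S.
Proof.
move=> Xx; have d0 : (0 < d)%N by apply: conformal_dim_gt0; exists e.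
have [_ _ _ [l [gamma [l0 g0 gpi h]]] _] := confS.
have [u u1 cone] := h _ _ Xx.
have [J0 JE] := similarityE d0 (emap_similarity Xx).
apply/ler_addgt0Pr => eta eta0.
have [u' | r r0 hr] := @differentiable_expanding_at R d (emap S e) x
  (opnorm (jacobian (emap S e) x)) eta (emap_differentiable Xx) _ eta0; first by rewrite JE.
pose t := Num.min l r / 2.
have m0 : 0 < Num.min l r by rewrite lt_min l0 r0.
have ml : Num.min l r <= l by rewrite ge_min lexx.
have mr : Num.min l r <= r by rewrite ge_min lexx orbT.
have [t0 tl tr] : [/\ 0 < t, t < l & t < r].
  by rewrite /t; move: (Num.min l r) m0 ml mr => m *; split; lra.
have tu : enorm (x + t *: u - x) = t by rewrite addrC addKr enormZ u1 mulr1 gtr0_norm.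
have Xt : space S (tgt S e) (x + t *: u).
  apply: interior_subset; apply: cone; rewrite /open_cone /= tu.
  have -> : x + t *: u - x = t *: u by rewrite addrC addKr.
  rewrite edotZl -enorm_sqr u1 expr1n mulr1; split => //.
  by rewrite gtr_pMl//; have /andP[] := cos_half_aperture g0 gpi.
have := hr (x + t *: u); rewrite tu => /(_ tr).
move=> /le_trans /(_ (emap_lipschitz Xt Xx)); rewrite tu ler_pM2r//; lra.
Qed.

Lemma opnorm_emap_holder : finite_set [set: E] ->
  exists B alpha : R, [/\ 0 <= B, 0 < alpha & forall e x y,
    space S (tgt S e) x -> space S (tgt S e) y ->
    `|opnorm (jacobian (emap S e) y) - opnorm (jacobian (emap S e) x)| <=
    B * enorm (y - x) `^ alpha].
Proof.
move=> finE; have [_ _ _ _ [L [alpha [L1 a0 h]]]] := confS.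
have [e b b' bb' le|e|b hb] := @finite_uniform_bound R E
  (fun e b => L * (dinv_sup S e)^-1 <= b) finE.
- exact: le_trans bb'.
- by exists (L * (dinv_sup S e)^-1).
exists `|b|, alpha; split => // e x y Xx Xy; apply: le_trans (h e x y Xx Xy) _.
by apply: ler_wpM2r; rewrite ?powR_ge0//; apply: le_trans (hb e) (ler_norm _).
Qed.

Lemma opnorm_emap_gt0 e x : space S (tgt S e) x -> 0 < opnorm (jacobian (emap S e) x).
Proof.
move=> Xx; have d0 : (0 < d)%N by apply: conformal_dim_gt0; exists e.
by have [] := similarityE d0 (emap_similarity Xx).
Qed.

Lemma opnorm_emap_ge : finite_set [set: E] ->
  exists2 c : R, 0 < c & forall e x, space S (tgt S e) x ->
    c <= opnorm (jacobian (emap S e) x).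
Proof.
move=> finE; have [B [alpha [B0 a0 hB]]] := opnorm_emap_holder finE.
have [||b hb] := @finite_uniform_bound R E (fun e b => forall x, space S (tgt S e) x ->
  1 <= b * opnorm (jacobian (emap S e) x)) finE.
- move=> e b b' bb' h x Xx; apply: le_trans (h x Xx) _.
  by apply: ler_wpM2r => //; exact: ltW (opnorm_emap_gt0 Xx).
- move=> e; have [x Xx|z Xz hz] := @compact_min R d (fun x => opnorm (jacobian (emap S e) x))
    (space S (tgt S e)) (space_nonempty S _) (@space_compact _ _ _ _ S (tgt S e)).
    apply/cvgrPdist_lt => eps eps0.
    pose r := (eps / (B + 1)) `^ alpha^-1.
    have B1 : 0 < B + 1 by rewrite ltr_wpDl.
    have r0 : 0 < r by rewrite powR_gt0// divr_gt0.
    apply/nbhs_enormP; exists r => // y yr Xy /=.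
    apply: le_lt_trans (hB _ _ _ Xy Xx) _; rewrite enormB.
    have : enorm (y - x) `^ alpha <= eps / (B + 1).
      have -> : eps / (B + 1) = r `^ alpha.
        by rewrite /r -powRrM mulVf ?gt_eqF// powRr1// divr_ge0// ltW.
      by apply: ge0_ler_powR; rewrite ?nnegrE ?enorm_ge0 ?ltW.
    rewrite ler_pdivlMr// => hh; have := powR_ge0 (enorm (y - x)) alpha.
    have [->|bn] := eqVneq (enorm (y - x) `^ alpha) 0; first by rewrite mulr0.
    by rewrite le_eqVlt eq_sym (negPf bn) /= => p0; lra.
  exists (opnorm (jacobian (emap S e) z))^-1 => x Xx.
  have z0 : 0 < opnorm (jacobian (emap S e) z).
    exact: opnorm_emap_gt0.
  have mul_ge1 (p q : R) : 0 < p -> p <= q -> 1 <= p^-1 * q.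
    by move=> p0 pq; rewrite mulrC ler_pdivlMr// mul1r.
  exact: mul_ge1 z0 (hz x Xx).
have [e|nE] := pselect ([set: E] !=set0); last first.
  by exists 1 => // e; exfalso; apply: nE; exists e.
have b0 : 0 < b.
  have [e0 _] := e; have [x Xx] := space_nonempty S (tgt S e0).
  have := hb _ _ Xx; have := opnorm_emap_gt0 Xx; rewrite ltNge; nra.
exists b^-1; rewrite ?invr_gt0// => e' x Xx.
by rewrite -[leLHS]mul1r ler_pdivrMr// mulrC; exact: hb.
Qed.

Lemma space_diameter_bound : finite_set [set: E] ->
  exists2 D : R, 0 < D & forall e x y, space S (tgt S e) x -> space S (tgt S e) y ->
    enorm (x - y) <= D.
Proof.
move=> finE; have [||b hb] := @finite_uniform_bound R E (fun e b => forall x,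
  space S (tgt S e) x -> enorm x <= b) finE.
- by move=> e b b' bb' h x Xx; apply: le_trans (h x Xx) bb'.
- move=> e; have [M [_ hM]] := compact_bounded (@space_compact _ _ _ _ S (tgt S e)).
  exists (d%:R * (M + 1)) => x Xx; apply: le_trans (enorm_le_norm _) _.
  by apply: ler_wpM2l => //; apply: (hM (M + 1)) => //; rewrite ltrDl.
exists (2 * `|b| + 1); first by rewrite ltr_wpDl// mulr_ge0.
move=> e x y Xx Xy; apply: le_trans (enormD _ _) _; rewrite enormN.
have := hb e x Xx; have := hb e y Xy; have := ler_norm b; lra.
Qed.

End conformal_maps.

(** * Maps of words and bounded distortion *)

Section word_maps.
Context {R : realType} {d : nat} {V : finType} {E : countType}.
Variable S : gdms R d V E.
Implicit Types (e : E) (w v : seq E) (x y : 'rV[R]_d).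

Lemma word_map_cat v w x : word_map S (v ++ w) x = word_map S v (word_map S w x).
Proof. by elim: v => //= e v IH; rewrite IH. Qed.

Lemma word_dom_cat v w : w != [::] -> word_dom S (v ++ w) = word_dom S w.
Proof. by case: w => // e w _; case: v => //= e' v; rewrite last_cat. Qed.

Lemma word_dom_nonempty w : word_dom S w !=set0.
Proof. by case: w => [|e w] /=; [exists 0|exact: space_nonempty]. Qed.

Lemma word_map_src e w x : path (incid S) e w -> word_dom S (e :: w) x ->
  space S (src S e) (word_map S (e :: w) x).
Proof.
elim: w e => [|e' w IH] e /=; first by move=> _ Xx; apply: emap_sub; exists x.
move=> /andP[/incid_tgt_src ee' pw] Xx; apply: emap_sub; rewrite ee'.
by exists (word_map S (e' :: w) x) => //; exact: IH.
Qed.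

Lemma word_map_dom v w x : sorted (incid S) (v ++ w) -> w != [::] ->
  word_dom S w x -> word_dom S v (word_map S w x).
Proof.
case: w => // e w; case: v => // e' v /=; rewrite cat_path /= => /and3P[_ ee pw] _ Xx.
by rewrite (incid_tgt_src ee); exact: word_map_src.
Qed.

Lemma word_map_lipschitz w x y : sorted (incid S) w -> word_dom S w x -> word_dom S w y ->
  enorm (word_map S w x - word_map S w y) <= ratio S ^+ size w * enorm (x - y).
Proof.
elim: w => [|e w IH] sw Xx Xy; first by rewrite mul1r.
have [w0|w0] := eqVneq w [::].
  by move: Xx Xy; rewrite w0 /= expr1 => Xx Xy; exact: emap_lipschitz.
have Xx' := @word_map_dom [:: e] w x sw w0; have Xy' := @word_map_dom [:: e] w y sw w0.
move: Xx Xy; rewrite -cat1s word_dom_cat// => Xx Xy.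
apply: le_trans (emap_lipschitz (Xx' Xx) (Xy' Xy)) _.
rewrite exprS -mulrA; apply: ler_wpM2l; first exact: ltW (ratio_gt0 S).
by apply: IH => //; exact: path_sorted sw.
Qed.

Hypothesis confS : conformal S.

Lemma word_map_differentiable w x : sorted (incid S) w -> word_dom S w x ->
  differentiable (word_map S w) x.
Proof.
elim: w => [|e w IH] sw Xx.
  exact: (@linear_differentiable R 'rV[R]_d 'rV[R]_d idfun x (fun (y : 'rV[R]_d) A => id)).
have [w0|w0] := eqVneq w [::].
  by move: Xx; rewrite w0 => Xx; exact: (emap_differentiable confS).
have Xx' := @word_map_dom [:: e] w x sw w0.
move: Xx; rewrite -cat1s word_dom_cat// => Xx.
apply: (@differentiable_comp R _ _ _ (word_map S w) (emap S e)).
  by apply: IH => //; exact: path_sorted sw.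
by apply: (emap_differentiable confS); exact: Xx' Xx.
Qed.

Lemma jacobian_cat v w x : sorted (incid S) (v ++ w) -> w != [::] -> word_dom S w x ->
  jacobian (word_map S (v ++ w)) x =
  jacobian (word_map S w) x *m jacobian (word_map S v) (word_map S w x) :> 'M[R]_d.
Proof.
move=> sw w0 Xx.
have -> : word_map S (v ++ w) = word_map S v \o word_map S w.
  by apply/funext => z; rewrite word_map_cat.
have [sv sw'] : sorted (incid S) v /\ sorted (incid S) w.
  by case/cat_sorted2: sw.
apply: jacobian_comp; first exact: word_map_differentiable.
by apply: word_map_differentiable => //; exact: word_map_dom.
Qed.

Lemma word_map_similarity w x : sorted (incid S) w -> word_dom S w x ->
  similarity (jacobian (word_map S w) x).
Proof.
elim: w => [|e w IH] sw Xx; first by rewrite jacobian_id; exact: similarity1.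
have [w0|w0] := eqVneq w [::].
  by move: Xx; rewrite w0 => Xx; exact: (emap_similarity confS).
have Xx' := @word_map_dom [:: e] w x sw w0.
move: Xx; rewrite -cat1s word_dom_cat// => Xx.
rewrite jacobian_cat//; apply: similarityM.
  by apply: IH => //; exact: path_sorted sw.
by apply: (emap_similarity confS); exact: Xx' Xx.
Qed.

Lemma word_map_open w x A : sorted (incid S) w -> word_dom S w x -> nbhs x A ->
  nbhs (word_map S w x) (word_map S w @` A).
Proof.
elim: w => [|e w IH] sw Xx nA; first by rewrite image_id.
have [w0|w0] := eqVneq w [::].
  by move: Xx; rewrite w0 => Xx; exact: (emap_open confS).
have Xx' := @word_map_dom [:: e] w x sw w0.
move: Xx; rewrite -cat1s word_dom_cat// => Xx.
have := emap_open confS (Xx' Xx) (IH (path_sorted sw) Xx nA).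
apply: filterS => _ [_ [y Ay <-] <-]; exists y => //.
Qed.

Hypothesis d_gt0 : (0 < d)%N.

Lemma dnorm_nil x : dnorm S [::] x = 1.
Proof. by rewrite /dnorm jacobian_id opnorm1. Qed.

Lemma dnorm_cat v w x : sorted (incid S) (v ++ w) -> w != [::] -> word_dom S w x ->
  dnorm S (v ++ w) x = dnorm S v (word_map S w x) * dnorm S w x.
Proof.
move=> svw w0 Xx; have [sv sw] := cat_sorted2 svw.
have hj := jacobian_cat svw w0 Xx.
have hM := opnormM d_gt0 (word_map_similarity sw Xx)
  (word_map_similarity sv (word_map_dom svw w0 Xx)).
exact: etrans (congr1 (@opnorm R d) hj) (etrans hM (mulrC _ _)).
Qed.

Lemma dnorm_gt0 w x : sorted (incid S) w -> word_dom S w x -> 0 < dnorm S w x.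
Proof. by move=> sw Xx; have [] := similarityE d_gt0 (word_map_similarity sw Xx). Qed.

Lemma dnorm_le w x : sorted (incid S) w -> word_dom S w x ->
  dnorm S w x <= ratio S ^+ size w.
Proof.
elim: w => [|e w IH] sw Xx; first by rewrite dnorm_nil.
have [w0|w0] := eqVneq w [::].
  by move: Xx; rewrite w0 expr1 => Xx; exact: (opnorm_emap_le confS).
have Xx' := @word_map_dom [:: e] w x sw w0.
move: Xx; rewrite -cat1s word_dom_cat// => Xx.
rewrite dnorm_cat// exprS; apply: ler_pM; last 2 first.
- by apply: (opnorm_emap_le confS); exact: Xx' Xx.
- by apply: IH => //; exact: path_sorted sw.
- by apply: ltW; apply: dnorm_gt0 => //; exact: Xx' Xx.
- by apply: ltW; apply: dnorm_gt0 => //; exact: path_sorted sw.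
Qed.

Lemma dnorm_ge (c : R) w x : 0 < c ->
  (forall e x, space S (tgt S e) x -> c <= opnorm (jacobian (emap S e) x)) ->
  sorted (incid S) w -> word_dom S w x -> c ^+ size w <= dnorm S w x.
Proof.
move=> c0 hc; elim: w => [|e w IH] sw Xx; first by rewrite dnorm_nil.
have [w0|w0] := eqVneq w [::].
  by move: Xx; rewrite w0 expr1 => Xx; exact: hc.
have Xx' := @word_map_dom [:: e] w x sw w0.
move: Xx; rewrite -cat1s word_dom_cat// => Xx.
rewrite dnorm_cat// exprS; apply: ler_pM; rewrite ?exprn_ge0 ?(ltW c0)//.
- by apply: hc; exact: Xx' Xx.
- by apply: IH => //; exact: path_sorted sw.
Qed.

(** The letters of a word act on images that shrink
    geometrically, so that the Hoelder condition bounds the logarithmic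
    variation of the derivative by a geometric series. *)
Lemma bounded_distortion : finite_set [set: E] ->
  exists2 K : R, 1 <= K & forall w x y, sorted (incid S) w -> w != [::] ->
    word_dom S w x -> word_dom S w y -> dnorm S w y <= K * dnorm S w x.
Proof.
move=> finE; have [B [alpha [B0 a0 hB]]] := opnorm_emap_holder confS finE.
have [c c0 hc] := opnorm_emap_ge confS finE.
have [D D0 hD] := space_diameter_bound S finE.
pose rho := ratio S `^ alpha; pose B' := B / c * D `^ alpha.
have s0 := ratio_gt0 S; have s1 := ratio_lt1 S.
have rho0 : 0 < rho by rewrite powR_gt0.
have rho1 : rho < 1.
  have one_pow : 1 `^ alpha = 1 :> R by rewrite powR1.
  by rewrite /rho -[ltRHS]one_pow; apply: gt0_ltr_powR; rewrite ?nnegrE ?ltW.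
have B'0 : 0 <= B' by rewrite !mulr_ge0 ?powR_ge0// invr_ge0 ltW.
have one e w x y : word_dom S [:: e] x -> word_dom S [:: e] y ->
    enorm (y - x) <= ratio S ^+ size w * D ->
    dnorm S [:: e] y <= expR (B' * rho ^+ size w) * dnorm S [:: e] x.
  move=> /= Xx Xy hxy; have qc : c <= dnorm S [:: e] x by exact: hc Xx.
  have h : `|dnorm S [:: e] y - dnorm S [:: e] x| <= B * enorm (y - x) `^ alpha.
    exact: hB Xx Xy.
  move: (dnorm S [:: e] x) (dnorm S [:: e] y) qc h => q p qc.
  rewrite ler_norml => /andP[_ h].
  have q0 : 0 < q by exact: lt_le_trans qc.
  have pw : enorm (y - x) `^ alpha <= rho ^+ size w * D `^ alpha.
    rewrite /rho -powR_exprM ?(ltW s0) ?(ltW D0)//.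
    have sD : 0 <= ratio S ^+ size w * D by rewrite mulr_ge0 ?exprn_ge0 ?(ltW s0) ?(ltW D0).
    by apply: ge0_ler_powR; rewrite ?nnegrE ?enorm_ge0// ltW.
  apply: (@le_trans _ _ ((1 + B' * rho ^+ size w) * q)); last first.
    by apply: ler_wpM2r; [exact: ltW|exact: expR_ge1Dx].
  have : B * enorm (y - x) `^ alpha <= B' * rho ^+ size w * q.
    apply: (@le_trans _ _ (B * (rho ^+ size w * D `^ alpha))); first exact: ler_wpM2l.
    have -> : B' * rho ^+ size w * q = B * (rho ^+ size w * D `^ alpha) * (q / c).
      by rewrite /B'; ring.
    rewrite ler_peMr// ?mulr_ge0 ?exprn_ge0 ?powR_ge0 ?(ltW rho0)//.
    by rewrite ler_pdivlMr// mul1r.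
  lra.
have K w x y : sorted (incid S) w -> w != [::] -> word_dom S w x -> word_dom S w y ->
    dnorm S w y <= expR (B' * (\sum_(j < size w) rho ^+ j)) * dnorm S w x.
  elim: w => // e w IH sw _ Xx Xy.
  have [w0|w0] := eqVneq w [::].
    rewrite w0 in Xx Xy *; rewrite /= big_ord_recr big_ord0 /= add0r.
    by apply: (one e [::]) => //; rewrite expr0 mul1r; exact: (hD e _ _ Xy Xx).
  have Xx' := @word_map_dom [:: e] w x sw w0; have Xy' := @word_map_dom [:: e] w y sw w0.
  move: Xx Xy; rewrite -cat1s word_dom_cat// => Xx Xy.
  rewrite !dnorm_cat// [size _]/= big_ord_recr /= mulrDr expRD.
  have sw' : sorted (incid S) w by exact: path_sorted sw.
  rewrite (mulrC (expR _)) mulrACA; apply: ler_pM.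
  - by apply: ltW; apply: dnorm_gt0 => //; exact: Xy' Xy.
  - exact: ltW (dnorm_gt0 sw' Xy).
  - apply: one; [exact: Xx' Xx|exact: Xy' Xy|].
    apply: le_trans (word_map_lipschitz sw' Xy Xx) _.
    apply: ler_wpM2l; first by rewrite exprn_ge0 ?ltW.
    by case: (w) w0 Xx Xy => // e' w' _ Xx Xy; exact: hD Xy Xx.
  - exact: IH.
exists (expR (B' / (1 - rho))).
  by apply: le_trans (expR_ge1Dx _); rewrite lerDl divr_ge0// subr_ge0 ltW.
move=> w x y sw w0 Xx Xy; apply: le_trans (K w x y sw w0 Xx Xy) _.
apply: ler_wpM2r; first exact: ltW (dnorm_gt0 sw Xx).
rewrite ler_expR; apply: ler_wpM2l => //.
have r1 : 0 < 1 - rho by rewrite subr_gt0.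
rewrite -[leRHS]mul1r ler_pdivlMr// mulrC.
have -> : (1 - rho) * \sum_(j < size w) rho ^+ j = 1 - rho ^+ size w.
  by rewrite -opprB mulNr -subrX1 opprB.
by rewrite lerBlDr lerDl exprn_ge0 ?ltW.
Qed.

End word_maps.

(** * Derivative norms, diameters and multiplicity of images *)

Section admissible_words.
Context {R : realType} {d : nat} {V : finType} {E : countType}.
Variable S : gdms R d V E.
Implicit Types (e : E) (w v : seq E) (omega : nat -> E).

Lemma sorted_mkseq_incid omega k n : inf_admissible S omega ->
  sorted (incid S) (mkseq (fun j => omega (k + j)%N) n).
Proof.
move=> adm; apply/(sortedP (omega 0%N)) => i; rewrite size_mkseq => i1n.
by rewrite !nth_mkseq// ?addnS//; exact: ltnW.
Qed.

Lemma sorted_extend e w : sorted (incid S) (e :: w) ->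
  exists2 omega, inf_admissible S omega & e :: w = mkseq omega (size w).+1.
Proof.
move=> sw; have /choice[next hn] := @incid_next _ _ _ _ S.
pose omega n := if (n <= size w)%N then nth e (e :: w) n
  else iter (n - size w) next (last e w).
exists omega => [n|]; last first.
  apply: (@eq_from_nth _ e); rewrite ?size_mkseq// => i iw.
  by rewrite nth_mkseq// /omega -ltnS iw.
rewrite /omega; case: ltngtP => [nw|nw|nw].
- by move/(sortedP e): sw; apply.
- by rewrite subSn ?(ltnW nw)//; exact: hn.
- by rewrite nw subSnn -[size w]/(size (e :: w)).-1 nth_last; exact: hn.
Qed.

Lemma admissible_sortedP w : [set: E] !=set0 ->
  admissible S w <-> sorted (incid S) w.
Proof.
move=> [e0 _]; split=> [[omega adm [k ->]]|sw]; first exact: sorted_mkseq_incid.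
case: w sw => [_|e w sw].
  by have [omega adm _] := @sorted_extend e0 [::] isT; exists omega => //; exists 0%N.
by have [omega adm wE] := sorted_extend sw; exists omega => //; exists 0%N.
Qed.

End admissible_words.

Section derivative_norms.
Context {R : realType} {d : nat} {V : finType} {E : countType}.
Variable S : gdms R d V E.
Hypotheses (confS : conformal S) (d_gt0 : (0 < d)%N).
Variables (c K : R).
Hypotheses (c_gt0 : 0 < c) (K_ge1 : 1 <= K).
Hypothesis emap_ge : forall e x, space S (tgt S e) x ->
  c <= opnorm (jacobian (emap S e) x).
Hypothesis distortion : forall w x y, sorted (incid S) w -> w != [::] ->
  word_dom S w x -> word_dom S w y -> dnorm S w y <= K * dnorm S w x.
Implicit Types (e : E) (w v : seq E) (x y : 'rV[R]_d).

Let ratio_ge0 : 0 <= ratio S. Proof. exact: ltW (ratio_gt0 S). Qed.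
Let K_gt0 : 0 < K. Proof. exact: lt_le_trans K_ge1. Qed.

Lemma has_sup_dnorm w : sorted (incid S) w ->
  has_sup [set dnorm S w x | x in word_dom S w].
Proof.
move=> sw; split; first by have [x Xx] := word_dom_nonempty S w; exists (dnorm S w x), x.
by exists (ratio S ^+ size w) => _ [x Xx <-]; exact: dnorm_le.
Qed.

Lemma dnorm_le_sup w x : sorted (incid S) w -> word_dom S w x ->
  dnorm S w x <= dnorm_sup S w.
Proof. by move=> sw Xx; apply: (ub_le_sup (proj2 (has_sup_dnorm sw))); exists x. Qed.

Lemma dnorm_sup_lub w (b : R) : sorted (incid S) w ->
  (forall x, word_dom S w x -> dnorm S w x <= b) -> dnorm_sup S w <= b.
Proof.
move=> sw h; apply: sup_le_ub; first by case: (has_sup_dnorm sw).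
by move=> _ [x Xx <-]; exact: h.
Qed.

Lemma dnorm_sup_le_distortion w x : sorted (incid S) w -> w != [::] ->
  word_dom S w x -> dnorm_sup S w <= K * dnorm S w x.
Proof. by move=> sw w0 Xx; apply: dnorm_sup_lub => // y Xy; exact: distortion. Qed.

Lemma dnorm_sup_nil : dnorm_sup S [::] = 1.
Proof.
apply/eqP; rewrite eq_le; apply/andP; split.
  by apply: dnorm_sup_lub => // x _; rewrite dnorm_nil.
by rewrite -(dnorm_nil S d_gt0 0); exact: dnorm_le_sup.
Qed.

Lemma dnorm_sup_le w : sorted (incid S) w -> dnorm_sup S w <= ratio S ^+ size w.
Proof. by move=> sw; apply: dnorm_sup_lub => // x Xx; exact: dnorm_le. Qed.

Lemma dnorm_sup_ge w : sorted (incid S) w -> c ^+ size w <= dnorm_sup S w.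
Proof.
move=> sw; have [x Xx] := word_dom_nonempty S w.
exact: le_trans (dnorm_ge confS d_gt0 c_gt0 emap_ge sw Xx) (dnorm_le_sup sw Xx).
Qed.

Lemma dnorm_sup_gt0 w : sorted (incid S) w -> 0 < dnorm_sup S w.
Proof. by move=> sw; apply: lt_le_trans (dnorm_sup_ge sw); rewrite exprn_gt0. Qed.

Lemma dnorm_sup_le1 w : sorted (incid S) w -> dnorm_sup S w <= 1.
Proof.
move=> sw; apply: le_trans (dnorm_sup_le sw) _.
by rewrite exprn_ile1// ltW// ratio_lt1.
Qed.

Lemma dnorm_sup_cat v w : sorted (incid S) (v ++ w) ->
  dnorm_sup S (v ++ w) <= dnorm_sup S v * dnorm_sup S w.
Proof.
move=> svw; have [sv sw] := cat_sorted2 svw.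
have [->|w0] := eqVneq w [::]; first by rewrite cats0 dnorm_sup_nil mulr1.
apply: dnorm_sup_lub => // x; rewrite word_dom_cat// => Xx; rewrite dnorm_cat//.
have Xwx := word_map_dom svw w0 Xx.
by apply: ler_pM; rewrite ?dnorm_le_sup// ltW// dnorm_gt0.
Qed.

Lemma dnorm_sup_rcons w e : sorted (incid S) (rcons w e) ->
  c / K * dnorm_sup S w <= dnorm_sup S (rcons w e).
Proof.
move=> swe; have [x Xx] := word_dom_nonempty S [:: e].
have swe' : sorted (incid S) (w ++ [:: e]) by rewrite cats1.
have [sw _] := cat_sorted2 swe'.
rewrite -cats1; apply: le_trans (dnorm_le_sup swe' _); last by rewrite word_dom_cat//; exact: Xx.
rewrite dnorm_cat// mulrC mulrA.
have Xe := word_map_dom swe' isT Xx.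
have ce : c <= dnorm S [:: e] x by exact: emap_ge.
apply: (@le_trans _ _ (dnorm S w (word_map S [:: e] x) * c)); last first.
  exact: ler_wpM2l (ltW (dnorm_gt0 confS d_gt0 sw Xe)) _ _ ce.
rewrite ler_pdivrMr// mulrAC ler_pM2r// mulrC.
have [->|w0] := eqVneq w [::]; first by rewrite dnorm_nil// dnorm_sup_nil mulr1.
exact: dnorm_sup_le_distortion.
Qed.

(** Take [y] half-way up the axis of a cone with vertex [x] contained in the
    interior. *)
Lemma deep_points : exists r h : R, [/\ 0 < r, 0 <= h & forall (v : V) x, space S v x ->
  exists y, [/\ enorm (y - x) <= h,
    forall t, 0 <= t <= 1 -> space S v (segment x y t) &
    forall z, enorm (z - y) < r -> interior (space S v) z]].
Proof.
have [_ _ _ [l [gamma [l0 g0 gpi cone]]] _] := confS.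
have /andP[k0 k1] := cos_half_aperture g0 gpi; set k := cos _ in k0 k1.
exists (l / 4 * (1 - k)), (l / 2); split; rewrite ?divr_ge0 ?(ltW l0)//.
  by rewrite mulr_gt0 ?divr_gt0// subr_gt0.
move=> v x Xx; have [u u1 hu] := cone v x Xx.
exists (x + (l / 2) *: u).
have yx : x + (l / 2) *: u - x = (l / 2) *: u by rewrite addrC addKr.
have l2 : 0 < l / 2 by rewrite divr_gt0.
split => [|t /andP[t0 t1]|z zy].
- by rewrite yx enormZ u1 mulr1 gtr0_norm.
- rewrite /segment yx; move: t0; rewrite le_eqVlt => /predU1P[<-|t0].
    by rewrite scale0r addr0.
  apply: interior_subset; apply: hu; rewrite /open_cone /= addrC addKr scalerA.
  have tl : 0 < t * (l / 2) by rewrite mulr_gt0.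
  rewrite enormZ gtr0_norm// edotZl -enorm_sqr u1 expr1n !mulr1 gtr_pMl//; split => //.
  nra.
- apply: hu; rewrite /open_cone /= -/k.
  have -> : z - x = (z - (x + (l / 2) *: u)) + (l / 2) *: u by rewrite opprD addrA subrK.
  move: zy; set q := z - _ => qr.
  rewrite edotDl edotZl -enorm_sqr u1 expr1n mulr1.
  have h1 : enorm (q + (l / 2) *: u) <= enorm q + l / 2.
    by apply: le_trans (enormD _ _) _; rewrite enormZ u1 mulr1 gtr0_norm.
  have := cauchy_schwarz q u; have := cauchy_schwarz (- q) u.
  rewrite enormN u1 mulr1 -scaleN1r edotZl => h2 h3; have := enorm_ge0 q.
  split; [nra|nra].
Qed.

Lemma word_map_mean_value w x y : sorted (incid S) w ->
  (forall t, 0 <= t <= 1 -> word_dom S w (segment x y t)) ->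
  enorm (word_map S w y - word_map S w x) <= dnorm_sup S w * enorm (y - x).
Proof.
move=> sw hseg; apply: mean_value_enorm => [|t t01|t u t01].
- exact: ltW (dnorm_sup_gt0 sw).
- by apply: word_map_differentiable => //; exact: hseg.
have Xt := hseg t t01.
have [_ hu] := similarityE d_gt0 (word_map_similarity confS sw Xt).
rewrite hu; apply: ler_wpM2r; first exact: enorm_ge0.
exact: dnorm_le_sup.
Qed.

(** The images of two points whose deep points are close are within a multiple of
    [dnorm_sup S w]; among boundedly many points two have close deep points; and
    by connectedness the distances to [word_map S w x] take all
    intermediate values. *)
Lemma word_map_diameter : finite_set [set: E] ->
  exists2 D : R, 0 < D & forall w x y, sorted (incid S) w -> w != [::] ->
    word_dom S w x -> word_dom S w y ->
    enorm (word_map S w y - word_map S w x) <= D * dnorm_sup S w.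
Proof.
move=> finE; have [r [h [r0 h0 deep]]] := deep_points.
have [D0 D00 hD0] := space_diameter_bound S finE.
have [N hN] := packing_bound (d := d) (divr_ge0 (ltW D00) (ltW r0)).
exists (N.+1%:R * (h + r + h)); first by rewrite mulr_gt0 ?ltr0n//; lra.
move=> w x y sw w0 Xx Xy; set f := word_map S w.
have [e we] : exists e, word_dom S w = space S (tgt S e).
  by case: w w0 @f sw Xx Xy => // e w *; exists (last e w).
rewrite we in Xx Xy.
have /choice[dp hdp] z : exists y, space S (tgt S e) z ->
  [/\ enorm (y - z) <= h, forall t, 0 <= t <= 1 -> space S (tgt S e) (segment z y t) &
    forall z', enorm (z' - y) < r -> interior (space S (tgt S e)) z'].
  have [/deep[y' hy']|nz] := pselect (space S (tgt S e) z); first by exists y'.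
  by exists 0.
have dpX z : space S (tgt S e) z -> space S (tgt S e) (dp z).
  by move=> /hdp[_ /(_ 1) h1 _]; rewrite segment1 ler01 lexx in h1; exact: h1.
have sup0 := dnorm_sup_gt0 sw.
have to_deep z : space S (tgt S e) z -> enorm (f (dp z) - f z) <= dnorm_sup S w * h.
  move=> Xz; have [hz sz _] := hdp z Xz.
  apply: le_trans (word_map_mean_value sw _) _; first by rewrite we.
  by apply: ler_wpM2l hz; exact: ltW.
have close z z' : space S (tgt S e) z -> space S (tgt S e) z' -> enorm (dp z - dp z') < r ->
    enorm (f z - f z') <= dnorm_sup S w * (h + r + h).
  move=> Xz Xz' zz'; have [_ _ bz'] := hdp z' Xz'.
  have h1 : enorm (f (dp z) - f (dp z')) <= dnorm_sup S w * r.
    apply: le_trans (word_map_mean_value sw _) _.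
      move=> t /andP[t0 t1]; rewrite we; apply: interior_subset; apply: bz'.
      rewrite /segment addrC addKr enormZ ger0_norm//.
      by apply: le_lt_trans zz'; rewrite ler_piMl// enorm_ge0.
    by apply: ler_wpM2l; exact: ltW.
  have := to_deep z Xz; have := to_deep z' Xz'.
  have := enorm_triangle (f (dp z)) (f z) (f z').
  have := enorm_triangle (f (dp z')) (f (dp z)) (f z').
  rewrite (enormB (f z) (f (dp z))); nra.
pose ell := enorm (f y - f x).
have mid t : 0 <= t <= ell -> exists2 z, space S (tgt S e) z & enorm (f z - f x) = t.
  move=> t0l; have [/(_ (tgt S e))[cX _] _ _ _ _] := confS.
  have := @connected_continuous_connected _ _ _ (fun z => enorm (f z - f x)) cX.
  have cf : {within space S (tgt S e), continuous (fun z => enorm (f z - f x))}.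
    apply/subspace_continuousP => z Xz; apply: cvg_within_filter.
    apply: (@continuous_comp _ _ _ f (fun q => enorm (q - f x))).
      by apply: differentiable_continuous; apply: word_map_differentiable => //; rewrite we.
    exact: edist_continuous.
  move=> /(_ cf)/connected_intervalP/(_ 0 ell); apply => //.
  - by exists x => //; rewrite subrr enorm0.
  - by exists y.
(* pigeonhole on [N + 1] points whose images have distances [j * ell / (N + 1)]
   to [f x] *)
pose tt (j : 'I_N.+1) := ell * (j%:R / N.+1%:R).
have N0 : 0 < N.+1%:R :> R by rewrite ltr0n.
have ell0 : 0 <= ell by exact: enorm_ge0.
have /choice[z hz] j : exists z, space S (tgt S e) z /\ enorm (f z - f x) = tt j.
  have [|z Xz zt] := mid (tt j); last by exists z.
  rewrite /tt mulr_ge0 ?divr_ge0//=; apply: ler_piMr => //.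
  by rewrite ler_pdivrMr// mul1r ler_nat ltnW.
have [i [j [ij dij]]] : exists i j, i != j /\ enorm (dp (z i) - dp (z j)) < r.
  apply: contrapT => nex; suff : (#|'I_N.+1| <= N)%N by rewrite card_ord ltnn.
  apply: (hN r (dp x) _ (dp \o z)) => //= [i|i j ij].
    by rewrite divfK ?gt_eqF//; apply: hD0; apply: dpX => //; exact: proj1 (hz i).
  by rewrite leNgt; apply/negP => lt; apply: nex; exists i, j.
have := close _ _ (proj1 (hz i)) (proj1 (hz j)) dij.
have := enorm_triangle (f (z j)) (f (z i)) (f x).
have := enorm_triangle (f (z i)) (f (z j)) (f x).
rewrite (enormB (f (z j)) (f (z i))) (proj2 (hz i)) (proj2 (hz j)) => h1 h2 h3.
have h4 : `|tt i - tt j| <= dnorm_sup S w * (h + r + h).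
  by rewrite ler_norml; apply/andP; split; lra.
have h5 : ell / N.+1%:R <= `|tt i - tt j|.
  rewrite /tt -mulrBr -mulrBl normrM (ger0_norm ell0) normrM normfV (gtr0_norm N0).
  rewrite mulrA -[X in X / _]mulr1; apply: ler_wpM2r; first by rewrite invr_ge0 ltW.
  apply: ler_wpM2l => //.
  have [lt|lt|/val_inj eq] := ltngtP i j; last by rewrite eq eqxx in ij.
    by rewrite distrC -natrB ?(ltnW lt)// normr_nat ler1n subn_gt0.
  by rewrite -natrB ?(ltnW lt)// normr_nat ler1n subn_gt0.
have := le_trans h5 h4; rewrite ler_pdivrMr// /ell => h6.
by apply: le_trans h6 _; rewrite (mulrC _ N.+1%:R) mulrA mulrAC.
Qed.

Lemma word_map_interior v w x : sorted (incid S) (v ++ w) -> w != [::] ->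
  interior (word_dom S w) x -> interior (word_dom S v) (word_map S w x).
Proof.
move=> svw w0 ix; have [_ sw] := cat_sorted2 svw.
have := word_map_open confS sw (interior_subset ix) ix.
by apply: filterS => _ [z Xz <-]; exact: word_map_dom.
Qed.

(** The open set condition separates the images of interiors at the first letter
    where two words differ. *)
Lemma incomparable_disjoint v w a b x y :
  sorted (incid S) (a :: v) -> sorted (incid S) (b :: w) -> src S a = src S b ->
  ~~ prefix (a :: v) (b :: w) -> ~~ prefix (b :: w) (a :: v) ->
  interior (word_dom S (a :: v)) x -> interior (word_dom S (b :: w)) y ->
  word_map S (a :: v) x <> word_map S (b :: w) y.
Proof.
have inner e u z : sorted (incid S) (e :: u) -> interior (word_dom S (e :: u)) z ->
    interior (space S (tgt S e)) (word_map S u z).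
  case: u => [|e' u] // seu iz.
  by apply: (@word_map_interior [:: e] (e' :: u)).
elim: v w a b => [|a' v IH] w a b sv sw ab npv npw ix iy eq.
  have [eab|nab] := eqVneq a b; first by move: npv; rewrite /= eab eqxx prefix0s.
  have [_ osc _ _ _] := confS; have := osc a b nab ab.
  move/seteqP => [/(_ (word_map S (b :: w) y)) h _]; apply: h; split.
    by exists (word_map S [::] x) => //; exact: inner ix.
  by exists (word_map S w y) => //; exact: inner iy.
have [eab|nab] := eqVneq a b; last first.
  have [_ osc _ _ _] := confS; have := osc a b nab ab.
  move/seteqP => [/(_ (word_map S (b :: w) y)) h _]; apply: h; split.
    by exists (word_map S (a' :: v) x) => //; exact: inner ix.
  by exists (word_map S w y) => //; exact: inner iy.
case: w sw npv npw iy eq => [|b' w] sw npv npw iy eq.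
  by move: npw; rewrite /= eab eqxx.
rewrite -eab in sw npv npw iy eq.
have /= /andP[aa' sv'] := sv; have /= /andP[ab' sw'] := sw.
apply: (IH w a' b' _ _ _ _ _ ix iy) => //.
- by rewrite -(incid_tgt_src aa') -(incid_tgt_src ab').
- by move: npv; rewrite /= eqxx.
- by move: npw; rewrite /= eqxx.
apply: (@emap_inj _ _ _ _ S a) eq.
- by apply: interior_subset; exact: (inner a (a' :: v)).
- by apply: interior_subset; exact: (inner a (b' :: w)).
Qed.

(** By bounded distortion the derivative at every point of the ball expands by at
    least [dnorm_sup S w / K]; half of this rate holds locally around the point. *)
Lemma word_map_covers_ball w y (r : R) : sorted (incid S) w -> w != [::] -> 0 < r ->
  (forall z, enorm (z - y) < r -> interior (word_dom S w) z) ->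
  forall z, enorm (z - word_map S w y) < dnorm_sup S w / (2 * K) * (r / 2) ->
  exists2 q, interior (word_dom S w) q & word_map S w q = z.
Proof.
move=> sw w0 r0 hr z hz; have N0 := dnorm_sup_gt0 sw.
have l0 : 0 < dnorm_sup S w / (2 * K) by rewrite divr_gt0// mulr_gt0.
have sub q : enorm (q - y) <= r / 2 -> word_dom S w q.
  by move=> qr; apply: interior_subset; apply: hr; lra.
have [||q qr||q qr <-] := open_expanding_cover (f := word_map S w) (x := y) _ l0 _ _ _ hz.
- by rewrite divr_gt0.
- move=> q qr; apply: differentiable_continuous; apply: word_map_differentiable => //.
  exact: sub.
- by move=> A nA; apply: word_map_open => //; apply: sub; exact: ltW.
- move=> q qr; have Xq := sub q (ltW qr).
  have [_ hu] := similarityE d_gt0 (word_map_similarity confS sw Xq).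
  have [u|r' r'0 hr'] := differentiable_expanding_at (l := dnorm_sup S w / K)
    (word_map_differentiable confS sw Xq) _ l0.
    rewrite hu; apply: ler_wpM2r; first exact: enorm_ge0.
    rewrite ler_pdivrMr// mulrC.
    exact: dnorm_sup_le_distortion sw w0 Xq.
  exists r' => // q' /hr'.
  suff -> : dnorm_sup S w / K - dnorm_sup S w / (2 * K) = dnorm_sup S w / (2 * K) by [].
  by field; rewrite gt_eqF.
- by exists q => //; apply: hr; lra.
Qed.

(** Derivative norms decrease along prefixes, so that these words form an antichain:
    each infinite word is cut where its derivative norm first drops to [r]. *)
Definition stopped (r : R) w := exists w' e,
  [/\ w = rcons w' e, sorted (incid S) w, dnorm_sup S w <= r & r < dnorm_sup S w'].

(** The images of the stopped words meeting a ball of radius [r] contain disjoint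
    balls of radius comparable to [r] around points at distance [O(r)] from its centre. *)
Lemma stopped_multiplicity : finite_set [set: E] -> exists M : nat,
  forall (r : R) (v : V) (z : 'rV[R]_d) (I : finType) (word : I -> seq E),
    0 < r -> injective word ->
    (forall i, [/\ stopped r (word i), forall e u, word i = e :: u -> src S e = v &
       exists2 q, word_dom S (word i) q & enorm (word_map S (word i) q - z) <= r]) ->
  (#|I| <= M)%N.
Proof.
move=> finE; have [r0 [h [r00 h0 deep]]] := deep_points.
have [D D0 hD] := word_map_diameter finE.
(* [c / K * r] bounds the norms of the stopped words from below, and
   [word_map_covers_ball] contributes the remaining factors *)
pose sigma := c / K / (2 * K) * (r0 / 2).
have sigma0 : 0 < sigma by rewrite !(mulr_gt0, divr_gt0, invr_gt0)//.
have [M hM] := packing_bound (d := d) (divr_ge0 (addr_ge0 (ltW D0) ler01) (ltW sigma0)).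
exists M => r v z I word rp winj hw.
have wn0 i : word i != [::].
  by have [[w' [e [-> _ _ _]]] _ _] := hw i; case: (w').
have sw i : sorted (incid S) (word i) by have [[w' [e []]]] := hw i.
have Nr i : dnorm_sup S (word i) <= r by have [[w' [e []]]] := hw i.
have Ngt i : c / K * r < dnorm_sup S (word i).
  have [[w' [e [wE sw' _ lt]]] _ _] := hw i.
  rewrite wE; apply: lt_le_trans (dnorm_sup_rcons _); last by rewrite -wE.
  by rewrite ltr_pM2l// divr_gt0.
have /choice[y hy] i : exists y, word_dom S (word i) y /\
    forall z, enorm (z - y) < r0 -> interior (word_dom S (word i)) z.
  have [x Xx] := word_dom_nonempty S (word i).
  have [e we] : exists e, word_dom S (word i) = space S (tgt S e).
    by case: (word i) (wn0 i) => // e w _; exists (last e w).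
  rewrite we in Xx *; have [y [_ /(_ 1) Xy hy]] := deep _ _ Xx.
  by rewrite segment1 ler01 lexx in Xy; exists y; split => //; exact: Xy.
have nprefix i j : i != j -> ~~ prefix (word i) (word j).
  move=> ij; apply/negP => /prefixP[t tE].
  have [[w' [e [wE swj _ lt]]] _ _] := hw j.
  case/lastP: t tE => [|t e'] tE.
    by move: ij; rewrite (winj _ _ (_ : word i = word j)) ?eqxx// tE cats0.
  have w'E : w' = word i ++ t.
    by move: tE; rewrite wE -rcons_cat => /rcons_inj[].
  have sit : sorted (incid S) (word i ++ t).
    by rewrite -w'E; move: swj; rewrite wE -cats1 => /cat_sorted2[].
  have [_ st] := cat_sorted2 sit.
  have h1 := ler_wpM2l (ltW (dnorm_sup_gt0 (sw i))) (dnorm_sup_le1 st).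
  rewrite mulr1 in h1; have h2 := le_trans (le_trans (dnorm_sup_cat sit) h1) (Nr i).
  by have := le_lt_trans h2; rewrite -w'E => /(_ _ lt); rewrite ltxx.
apply: (hM (sigma * r) z _ (fun i => word_map S (word i) (y i))) => [||i j ij].
- exact: mulr_gt0.
- move=> i; rewrite mulrA divfK ?gt_eqF//.
  have [_ _ [q Xq qz]] := hw i.
  apply: le_trans (enorm_triangle (word_map S (word i) q) _ _) _.
  have := hD _ _ _ (sw i) (wn0 i) Xq (proj1 (hy i)).
  by have := Nr i; nra.
rewrite leNgt; apply/negP; rewrite enormB => lt.
have [|q iq qE] := word_map_covers_ball (sw i) (wn0 i) r00 (proj2 (hy i))
  (z := word_map S (word j) (y j)).
  apply: lt_le_trans lt _; rewrite /sigma mulrAC; apply: ler_wpM2r; first by rewrite ltW// divr_gt0.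
  rewrite mulrAC; apply: ler_wpM2r; first by rewrite invr_ge0 mulr_ge0 ?ltW.
  exact: ltW.
have iy : interior (word_dom S (word j)) (y j).
  by apply: (proj2 (hy j)); rewrite subrr enorm0.
have [_ si _] := hw i; have [_ sj _] := hw j.
have ni := nprefix _ _ ij; have nj := nprefix j i.
rewrite eq_sym in nj; have {}nj := nj ij.
move: (sw i) (sw j) (wn0 i) (wn0 j) si sj ni nj iq iy qE.
case: (word i) => // a u; case: (word j) => // b u' swi swj _ _ si sj ni nj iq iy.
by apply: incomparable_disjoint => //; rewrite (si a u)// (sj b u').
Qed.

End derivative_norms.

(** * Coding map and components *)

Lemma nested_compact (T : ptopologicalType) (C : nat -> set T) : hausdorff_space T ->
  (forall n, compact (C n)) -> (forall n, C n !=set0) -> (forall n, C n.+1 `<=` C n) ->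
  \bigcap_n C n !=set0.
Proof.
move=> hT cC C0 dC.
have mono m n : (m <= n)%N -> C n `<=` C m.
  elim: n => [|n IH]; first by rewrite leqn0 => /eqP->.
  by rewrite leq_eqVlt => /predU1P[->//|/IH h]; exact: subset_trans (dC n) h.
pose F : set_system T := filter_from setT C.
have FF : ProperFilter F.
  apply: filter_from_proper => [|n _]; last exact: C0.
  apply: filter_from_filter; first by exists 0%N.
  move=> i j _ _; exists (maxn i j) => // x Cx.
  by split; apply: mono Cx; rewrite ?leq_maxl ?leq_maxr.
have FC n : F (C n) by exists n.
have [p [_ cp]] := cC 0%N F FF (FC 0%N).
exists p => n _; have /compact_closed : compact (C n) by [].
by move=> /(_ hT); apply => B nB; exact: cp.
Qed.

Lemma mkseq_cat (T : Type) (f : nat -> T) m n :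
  mkseq f (m + n) = mkseq f m ++ mkseq (fun j => f (m + j)%N) n.
Proof. by rewrite /mkseq iotaD map_cat add0n -{2}[m]addn0 iotaDl -map_comp. Qed.

Section coding.
Context {R : realType} {d : nat} {V : finType} {E : countType}.
Variable S : gdms R d V E.
Hypotheses (confS : conformal S) (finE : finite_set [set: E]).
Implicit Types (e : E) (w v : seq E) (x y : 'rV[R]_d) (omega : nat -> E).

Lemma word_dom_rcons w e : word_dom S (rcons w e) = space S (tgt S e).
Proof. by case: w => //= e' w; rewrite last_rcons. Qed.

Lemma sorted_prefix omega n : inf_admissible S omega -> sorted (incid S) (mkseq omega n).
Proof. exact: (sorted_mkseq_incid 0). Qed.

Definition cylinder omega n : set 'rV[R]_d :=
  word_map S (mkseq omega n.+1) @` space S (tgt S (omega n)).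

Lemma cylinder_nested omega n : inf_admissible S omega ->
  cylinder omega n.+1 `<=` cylinder omega n.
Proof.
move=> adm _ [x Xx <-]; rewrite mkseqS -cats1 word_map_cat.
exists (emap S (omega n.+1) x) => //.
rewrite (incid_tgt_src (adm n)); apply: emap_sub; by exists x.
Qed.

Lemma cylinder_compact omega n : inf_admissible S omega -> compact (cylinder omega n).
Proof.
move=> adm; apply: continuous_compact; last exact: space_compact.
apply/subspace_continuousP => x Xx; apply: cvg_within_filter.
apply: differentiable_continuous; apply: word_map_differentiable => //.
  exact: sorted_prefix.
by rewrite mkseqS word_dom_rcons.
Qed.

Lemma coding_mem omega n : inf_admissible S omega ->
  cylinder omega n (coding_map S omega).2.
Proof.
move=> adm; have : \bigcap_n cylinder omega n !=set0.
  apply: nested_compact => [|n'|n'|n'].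
  - exact: norm_hausdorff.
  - exact: cylinder_compact.
  - have [x Xx] := space_nonempty S (tgt S (omega n')).
    by exists (word_map S (mkseq omega n'.+1) x), x.
  - exact: cylinder_nested.
by move=> h; have := getPex h; apply.
Qed.

(** The diameter of [cylinder omega n] is at most a constant times the [n]-th power
    of the contraction ratio. *)
Lemma coding_unique omega y : inf_admissible S omega ->
  (forall n, cylinder omega n y) -> y = (coding_map S omega).2.
Proof.
move=> adm hy; have [D D0 hD] := space_diameter_bound S finE.
apply/eqP; rewrite -subr_eq0; apply/eqP/enorm_eq0/eqP.
rewrite eq_le enorm_ge0 andbT; apply/ler_addgt0Pr => e e0; rewrite add0r.
have s1 : `|ratio S| < 1 by rewrite gtr0_norm ?ratio_gt0// ratio_lt1.
have [n sn] : exists n, ratio S ^+ n < e / D.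
  have /cvgrPdist_lt /(_ (e / D)) := cvg_expr s1; rewrite divr_gt0// => /(_ isT)[n _ hn].
  exists n; have := hn n (leqnn n); rewrite /= distrC subr0 ger0_norm//.
  by rewrite exprn_ge0// ltW// ratio_gt0.
have [x Xx xE] := hy n; have [x' Xx' xE'] := coding_mem n adm.
rewrite -xE -xE'; have sw : sorted (incid S) (mkseq omega n.+1) by exact: sorted_prefix.
apply: le_trans (word_map_lipschitz sw _ _) _; rewrite ?mkseqS ?word_dom_rcons//.
rewrite size_rcons size_mkseq; apply: (@le_trans _ _ (ratio S ^+ n * D)).
  have s0 : 0 <= ratio S by exact: ltW (ratio_gt0 S).
  apply: ler_pM; [by rewrite exprn_ge0|exact: enorm_ge0| |exact: hD Xx Xx'].
  by rewrite exprS; apply: ler_piMl; [rewrite exprn_ge0|exact: ltW (ratio_lt1 S)].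
by apply: ltW; rewrite -ltr_pdivlMr.
Qed.

Lemma coding_shift omega n : inf_admissible S omega ->
  let tail := fun j => omega (n.+1 + j)%N in
  [/\ inf_admissible S tail, word_dom S (mkseq omega n.+1) (coding_map S tail).2 &
   (coding_map S omega).2 = word_map S (mkseq omega n.+1) (coding_map S tail).2].
Proof.
move=> adm tail; have admt : inf_admissible S tail.
  by move=> j; rewrite /tail addnS; exact: adm.
have Xt : word_dom S (mkseq omega n.+1) (coding_map S tail).2.
  have [x Xx <-] := coding_mem 0 admt; rewrite mkseqS word_dom_rcons.
  rewrite (incid_tgt_src (adm n)) -[omega n.+1]/(omega n.+1) -[n.+1]addn0.
  by apply: emap_sub; exists x.
split => //; apply/esym/coding_unique => // j.
have [jn|nj] := leqP j n; last first.
  have [k ->] : exists k, j = (n.+1 + k)%N by exists (j - n.+1)%N; rewrite subnKC.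
  have [x Xx xE] := coding_mem k admt; exists x => //.
  rewrite -xE -word_map_cat; congr (word_map S _ x).
  by rewrite -addnS mkseq_cat.
have mono k : (k <= n)%N -> cylinder omega n `<=` cylinder omega k.
  elim: n {Xt tail admt jn} => [|m IH]; first by rewrite leqn0 => /eqP->.
  by rewrite leq_eqVlt => /predU1P[->//|/IH h]; apply: subset_trans h; exact: cylinder_nested.
apply: (mono j jn); exists (coding_map S tail).2 => //.
by move: Xt; rewrite mkseqS word_dom_rcons.
Qed.

End coding.

Section components.
Context {R : realType} {d : nat} {V : finType} {E : countType}.
Variable S : gdms R d V E.
Implicit Types (e a b : E) (w v : seq E) (C : set E).

Definition reach a b := exists w, path (incid S) a (rcons w b).

Lemma reach_trans a b c : reach a b -> reach b c -> reach a c.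
Proof.
move=> [w wp] [v vp]; exists (rcons w b ++ v).
by rewrite rcons_cat cat_path wp last_rcons.
Qed.

Definition mutual a : set E := [set b | reach a b /\ reach b a].

Lemma reach_along a w b x : path (incid S) a (rcons w b) -> x \in w ->
  reach a x /\ reach x b.
Proof.
move=> pw /splitPr xw; case: xw pw => v1 v2 pw.
move: pw; rewrite rcons_cat cat_path /= => /and3P[p1 p2 p3].
split; last by exists v2.
by exists v1; rewrite rcons_path p1.
Qed.

Lemma mutual_strongly_connected a : strongly_connected S (mutual a).
Proof.
move=> b c [ab ba] [ac ca]; have [w wp] := reach_trans ba ac.
exists w; split; first by apply/(admissible_sortedP S _) => //; exists a.
move=> x; rewrite inE mem_rcons inE => /or3P[/eqP->//|/eqP->//|xw].
have [bx xc] := reach_along wp xw.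
by split; [exact: reach_trans ab bx|exact: reach_trans xc ca].
Qed.

Lemma strongly_connected_reach C a b : strongly_connected S C -> C a -> C b -> reach a b.
Proof.
move=> sC Ca Cb; have [w [adm _]] := sC a b Ca Cb; exists w.
exact: (proj1 (@admissible_sortedP _ _ _ _ S (a :: rcons w b) (ex_intro _ a I)) adm).
Qed.

Lemma mutual_component a : reach a a -> strongly_connected_component S (mutual a).
Proof.
move=> aa; split; first exact: mutual_strongly_connected.
move=> C sC mC; apply/seteqP; split=> // b Cb; have Ca : C a by exact: mC.
by split; exact: strongly_connected_reach sC _ _.
Qed.

Lemma reach_omega (omega : nat -> E) m n : inf_admissible S omega -> (m < n)%N ->
  reach (omega m) (omega n).
Proof.
move=> adm mn; exists (mkseq (fun j => omega (m + (1 + j))%N) (n - m.+1)).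
have := sorted_mkseq_incid m (1 + (n - m.+1).+1) adm.
rewrite mkseq_cat [mkseq _ (n - m.+1).+1]mkseqS /= addn0.
by have -> : (m + (1 + (n - m.+1)) = n)%N by lia.
Qed.

Lemma recurrent_letter (omega : nat -> E) : finite_set [set: E] ->
  exists a, forall N, exists2 n, (N <= n)%N & omega n = a.
Proof.
move=> /finite_seqP[es Ees].
have ees e : e \in es by have := I : [set: E] e; rewrite Ees.
apply: contrapT => nrec.
have /choice[N hN] a : exists N, forall n, (N <= n)%N -> omega n <> a.
  apply: contrapT => h; apply: nrec; exists a => N; apply: contrapT => h'.
  by apply: h; exists N => n Nn eq; apply: h'; exists n.
pose M := (\max_(e <- es) N e)%N.
have leM e : (N e <= M)%N by rewrite /M (big_rem e)//= leq_maxl.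
exact: (hN (omega M) M (leM _) erefl).
Qed.

Lemma recurrent_tail (omega : nat -> E) a m : inf_admissible S omega ->
  (forall N, exists2 n, (N <= n)%N & omega n = a) -> omega m = a ->
  forall n, (m < n)%N -> mutual a (omega n).
Proof.
move=> adm rec ma n mn; split; first by rewrite -ma; exact: reach_omega.
by have [k nk <-] := rec n.+1; exact: reach_omega.
Qed.

End components.

(** * The dimension of the limit set as a maximum over components *)

Lemma exists_maximizer (R : realType) (E : choiceType) (f : E -> \bar R) (P : set E) :
  finite_set [set: E] -> P !=set0 ->
  exists2 a, P a & forall b, P b -> (f b <= f a)%E.
Proof.
move=> /finite_seqP[es Ees] [b0 Pb0].
have ees e : e \in es by have := I : [set: E] e; rewrite Ees.
suff [h|[a Pa ha]] : (forall b, b \in es -> ~ P b) \/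
    exists2 a, P a & forall b, b \in es -> P b -> (f b <= f a)%E.
- by have := h b0 (ees b0).
- by exists a => // b; exact: ha.
elim: es {Ees ees} => [|e es [IH|[a Pa IH]]]; first by left.
- have [Pe|nPe] := pselect (P e).
    by right; exists e => // b; rewrite inE => /predU1P[->//|/IH].
  by left => b; rewrite inE => /predU1P[->|/IH].
- right; have [Pe|nPe] := pselect (P e); last first.
    by exists a => // b; rewrite inE => /predU1P[->//|]; exact: IH.
  have [ea|ae] := leP (f e) (f a).
    by exists a => // b; rewrite inE => /predU1P[->//|]; exact: IH.
  exists e => // b; rewrite inE => /predU1P[->//|/IH h /h hb].
  exact: le_trans hb (ltW ae).
Qed.

Section limit_sets.
Context {R : realType} {d : nat} {V : finType} {E : countType}.
Variable S : gdms R d V E.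
Implicit Types (e a : E) (w v : seq E) (p q : V * 'rV[R]_d) (omega : nat -> E).

Lemma union_dist_refl p : union_dist p p = 0.
Proof. by rewrite /union_dist subrr enorm0 eqxx addr0. Qed.

Lemma enorm_le_union_dist p q : enorm (p.2 - q.2) <= union_dist p q.
Proof. by rewrite /union_dist lerDl. Qed.

Lemma union_dist_lt1 p q : union_dist p q < 1 -> p.1 = q.1.
Proof.
rewrite /union_dist; have := enorm_ge0 (p.2 - q.2).
by case: eqP => //= _; move=> h; rewrite ltNge lerDr h.
Qed.

Lemma limit_set_mono (C C' : set E) : C `<=` C' -> limit_set S C `<=` limit_set S C'.
Proof. by move=> CC' _ [omega [adm Co] <-]; exists omega => //; split => // n; exact: CC'. Qed.

Hypotheses (confS : conformal S) (finE : finite_set [set: E]).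

(** An infinite word eventually stays in one component, so that the limit set is a
    countable union of Lipschitz images of limit sets of components. *)
Lemma hausdorff_null_components (u : R) : 0 <= u ->
  (forall a, reach S a a -> hausdorff_null union_dist u (limit_set S (mutual S a))) ->
  hausdorff_null union_dist u (limit_set S [set: E]).
Proof.
move=> u0 hnull.
pose lift w p := if w is e :: _ then (src S e, word_map S w p.2) else p.
(* the images under [word_map S w] of the limit set of the component of [a] *)
pose B i : set (V * 'rV[R]_d) := if (unpickle i : option (E * seq E)) is Some (a, w) then
  if `[< reach S a a >] && sorted (incid S) w then
    lift w @` (limit_set S (mutual S a) `&` [set p | word_dom S w p.2])
  else set0 else set0.
have null0 : hausdorff_null union_dist u (set0 : set (V * 'rV[R]_d)).
  move=> delta eps d0 e0; exists (fun=> set0); split => // [k|].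
    by apply: (diameter_le (dist := union_dist)) => x y [].
  by rewrite eseries0 ?lee_fin ?ltW// => k _ _; exact: hausdorff_weight0.
apply: (@hausdorff_null_subset _ _ _ _ _ (\bigcup_i B i)); last first.
  apply: hausdorff_null_bigcup => i; rewrite /B.
  case: unpickle => // -[a w]; case: ifP => // /andP[/asboolP aa sw].
  apply: (hausdorff_null_image union_dist_refl) => //; last exact: hnull.
  case: w sw => // e w sw p q Xp Xq; rewrite {1}/union_dist eqxx addr0 /=.
  apply: le_trans (enorm_le_union_dist p q).
  apply: le_trans (word_map_lipschitz sw Xp Xq) _.
  apply: ler_piMl; first exact: enorm_ge0.
  by rewrite exprn_ile1// ltW ?ratio_gt0 ?ratio_lt1.
move=> _ [omega [adm _] <-].
have [a rec] := recurrent_letter omega finE.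
have [n _ na] := rec 0%N.
have aa : reach S a a.
  by have [k nk ka] := rec n.+1; rewrite -{1}na -ka; exact: reach_omega.
have [admt Xt codE] := coding_shift confS finE n adm.
exists (pickle (a, mkseq omega n.+1)) => //; rewrite /B pickleK.
have -> : `[< reach S a a >] && sorted (incid S) (mkseq omega n.+1).
  by apply/andP; split; [exact/asboolP|exact: sorted_prefix].
exists (coding_map S (fun j => omega (n.+1 + j)%N)); last first.
  by rewrite /lift; apply/esym; rewrite [LHS]surjective_pairing codE.
split => //; exists (fun j => omega (n.+1 + j)%N) => //; split => // j.
by apply: recurrent_tail adm rec na _ _; rewrite addSn ltnS leq_addr.
Qed.

Lemma HD_limit_set_components :
  is_max [set HD (limit_set S C) | C in [set C | strongly_connected_component S C]]
         (HD (limit_set S [set: E])).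
Proof.
split; last first.
  move=> _ [C _ <-]; apply: hausdorff_dim_mono; exact: limit_set_mono.
have [[e0 _]|nE] := pselect ([set: E] !=set0); last first.
  have E0 : [set: E] = set0 by apply/seteqP; split => // e _; apply: nE; exists e.
  exists [set: E] => //; split => [c1|C' _ sub]; first by case: nE; exists c1.
  by apply/seteqP; split.
have [a0 aa0] : exists a, reach S a a.
  have [omega adm _] := @sorted_extend _ _ _ _ S e0 [::] isT.
  have [a rec] := recurrent_letter omega finE.
  have [n _ na] := rec 0%N; have [k nk ka] := rec n.+1.
  by exists a; rewrite -{1}na -ka; exact: reach_omega.
have rec0 : [set a | reach S a a] !=set0 by exists a0.
have [a aa hmax] := exists_maximizer (fun a => HD (limit_set S (mutual S a))) finE rec0.
exists (mutual S a); first exact: mutual_component.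
apply/eqP; rewrite eq_le; apply/andP; split.
  by apply: hausdorff_dim_mono; exact: limit_set_mono.
apply/lee_addgt0Pr => eps eps0.
have := hausdorff_dim_ge0 union_dist (limit_set S (mutual S a)); rewrite -/(HD _).
case hE : (HD (limit_set S (mutual S a))) => [u| |]// u0; last by rewrite leey.
have ue0 : 0 <= u + eps by rewrite addr_ge0// ltW.
rewrite -EFinD; apply: hausdorff_dim_le => //; apply: hausdorff_null_components => //.
move=> b bb; apply: (hausdorff_dim_lt union_dist_refl).
by apply: le_lt_trans (hmax b bb) _; rewrite hE lte_fin ltrDl.
Qed.

End limit_sets.

(** * Pressure and Hausdorff measure *)

Lemma finite_uniq_seq (T : eqType) (A : set T) : finite_set A ->
  exists2 s : seq T, uniq s & A = [set` s].
Proof.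
move=> /finite_seqP[s As]; exists (undup s); first exact: undup_uniq.
by rewrite As; apply/seteqP; split => x /=; rewrite mem_undup.
Qed.

Section partition_function.
Context {R : realType} {d : nat} {V : finType} {E : countType}.
Variable S : gdms R d V E.
Hypotheses (confS : conformal S) (d_gt0 : (0 < d)%N) (finE : finite_set [set: E]).
Variables (c K : R).
Hypotheses (c_gt0 : 0 < c) (K_ge1 : 1 <= K).
Hypothesis emap_ge : forall e x, space S (tgt S e) x ->
  c <= opnorm (jacobian (emap S e) x).
Hypothesis distortion : forall w x y, sorted (incid S) w -> w != [::] ->
  word_dom S w x -> word_dom S w y -> dnorm S w y <= K * dnorm S w x.
(* [N] is [dnorm_sup S], kept abstract: the arguments below are about
   submultiplicative weights on words. *)
Variables (N : seq E -> R) (e0 : E) (es : seq E).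
Hypothesis NE : forall w, dnorm_sup S w = N w.
Hypotheses (es_uniq : uniq es) (mem_es : forall e, e \in es).
Implicit Types (u t : R) (w v : seq E) (omega : nat -> E).

Let s0 : 0 < ratio S. Proof. exact: ratio_gt0. Qed.
Let s1 : ratio S < 1. Proof. exact: ratio_lt1. Qed.

Let N_nil : N [::] = 1.
Proof. by rewrite -NE; exact: (dnorm_sup_nil confS d_gt0). Qed.

Let N_gt0 w : sorted (incid S) w -> 0 < N w.
Proof. by rewrite -NE; exact: (dnorm_sup_gt0 confS d_gt0 c_gt0 emap_ge). Qed.

Let N_ge w : sorted (incid S) w -> c ^+ size w <= N w.
Proof. by rewrite -NE; exact: (dnorm_sup_ge confS d_gt0 c_gt0 emap_ge). Qed.

Let N_le w : sorted (incid S) w -> N w <= ratio S ^+ size w.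
Proof. by rewrite -NE; exact: (dnorm_sup_le confS d_gt0). Qed.

Let N_cat v w : sorted (incid S) (v ++ w) -> N (v ++ w) <= N v * N w.
Proof. by rewrite -!NE; exact: (dnorm_sup_cat confS d_gt0). Qed.

Let N_diameter : exists2 D : R, 0 < D & forall w x y, sorted (incid S) w -> w != [::] ->
  word_dom S w x -> word_dom S w y -> enorm (word_map S w y - word_map S w x) <= D * N w.
Proof.
have [D D0 hD] := word_map_diameter confS d_gt0 c_gt0 emap_ge finE.
by exists D => // w x y; rewrite -NE; exact: hD.
Qed.

(** With weight zero off the admissible words, sums range over all words, where
    concatenation is a bijection. *)
Definition weight u w : R :=
  if sorted (incid S) w then N w `^ u else 0.

Definition partition_fun u n := \sum_(w <- words es n) weight u w.

Lemma weight_ge0 u w : 0 <= weight u w.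
Proof. by rewrite /weight; case: ifP => // _; exact: powR_ge0. Qed.

Lemma weight_nil u : weight u [::] = 1.
Proof. by rewrite /weight /= N_nil powR1. Qed.

Lemma weight_cat u v w : 0 <= u -> weight u (v ++ w) <= weight u v * weight u w.
Proof.
move=> u0; rewrite /weight; case: ifPn => [svw|_]; last first.
  by apply: mulr_ge0; exact: weight_ge0.
have [sv sw] := cat_sorted2 svw; rewrite sv sw.
have Nv := ltW (N_gt0 sv); have Nw := ltW (N_gt0 sw).
rewrite -(powRM _ Nv Nw); apply: ge0_ler_powR => //.
- by rewrite nnegrE; exact: ltW (N_gt0 svw).
- by rewrite nnegrE; exact: mulr_ge0 Nv Nw.
- exact: N_cat.
Qed.

Lemma partition_add u m n : 0 <= u ->
  partition_fun u (m + n) <= partition_fun u m * partition_fun u n.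
Proof.
move=> u0; rewrite /partition_fun sum_words_cat mulr_suml; apply: ler_sum => v _.
by rewrite mulr_sumr; apply: ler_sum => w _; exact: weight_cat.
Qed.

Lemma sorted_word n : exists2 w, w \in words es n & sorted (incid S) w.
Proof.
have [omega adm _] := @sorted_extend _ _ _ _ S e0 [::] isT.
exists (mkseq omega n); last exact: sorted_prefix.
by rewrite mem_words size_mkseq eqxx; apply/allP => e _; exact: mem_es.
Qed.

Lemma size_words n w : w \in words es n -> size w = n.
Proof. by rewrite mem_words => /andP[/eqP]. Qed.

Lemma partition_ge u n : 0 <= u -> (c ^+ n) `^ u <= partition_fun u n.
Proof.
move=> u0; have [w ww sw] := sorted_word n.
rewrite /partition_fun (big_rem w)//=; apply: (@le_trans _ _ (weight u w)); last first.
  by rewrite lerDl; apply: sumr_ge0 => v _; exact: weight_ge0.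
rewrite /weight sw; apply: ge0_ler_powR => //.
- by rewrite nnegrE exprn_ge0// ltW.
- by rewrite nnegrE; exact: ltW (N_gt0 sw).
- by rewrite -(size_words ww); exact: N_ge.
Qed.

Lemma partition_gt0 u n : 0 <= u -> 0 < partition_fun u n.
Proof. by move=> u0; apply: lt_le_trans (partition_ge n u0); rewrite powR_gt0 ?exprn_gt0. Qed.

(** The derivative norm of a word of length [n] lies between [c ^+ n] and
    [ratio S ^+ n], so that its powers with exponents [u] and [t] compare. *)
Lemma partition_exponent u t n : u <= t ->
  (c ^+ n) `^ (t - u) * partition_fun u n <= partition_fun t n /\
  partition_fun t n <= (ratio S ^+ n) `^ (t - u) * partition_fun u n.
Proof.
move=> ut; have tu : 0 <= t - u by rewrite subr_ge0.
have key w : w \in words es n -> (c ^+ n) `^ (t - u) * weight u w <= weight t w /\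
    weight t w <= (ratio S ^+ n) `^ (t - u) * weight u w.
  move=> ww; rewrite /weight; case: ifPn => [sw|_]; last by rewrite !mulr0.
  have -> : N w `^ t = N w `^ (t - u) * N w `^ u.
    by rewrite -powRD ?subrK//; apply/implyP => _; rewrite gt_eqF// N_gt0.
  have Nw := ltW (N_gt0 sw).
  split; apply: ler_wpM2r; rewrite ?powR_ge0//; apply: ge0_ler_powR => //.
  - by rewrite nnegrE exprn_ge0// ltW.
  - by rewrite -(size_words ww); exact: N_ge.
  - by rewrite nnegrE exprn_ge0// ltW.
  - by rewrite -(size_words ww); exact: N_le.
by split; rewrite /partition_fun mulr_sumr big_seq [leRHS]big_seq; apply: ler_sum => w /key[].
Qed.

Lemma Zsum_partition u n : Zsum S n u = (partition_fun u n)%:E.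
Proof.
have E0 : [set: E] !=set0 by exists e0.
rewrite /Zsum; under eq_esum do rewrite NE.
have -> : admissible_of_size S n = [set` [seq w <- words es n | sorted (incid S) w]].
  apply/seteqP; split => w /=; rewrite mem_filter mem_words.
    move=> [/(admissible_sortedP S _ E0) -> ->]; rewrite eqxx /=.
    by apply/allP => e _; exact: mem_es.
  by move=> /and3P[sw /eqP sz _]; split => //; apply/(admissible_sortedP S _ E0).
rewrite esum_fset; [|exact/finite_seqP/(ex_intro _ _ erefl)|by move=> w _; rewrite lee_fin powR_ge0].
rewrite -fsbig_seq; last by apply: filter_uniq; exact: words_uniq.
rewrite big_filter sumEFin /partition; congr (_%:E).
by rewrite big_mkcond; apply: eq_bigr.
Qed.

Lemma theta_eq0 : theta S = 0%E.
Proof.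
apply/eqP; rewrite eq_le; apply/andP; split.
  apply: ereal_inf_lbound; exists 0 => //; split => //.
  by exists 0%N => // n _ /=; rewrite Zsum_partition ltry.
by apply: le_ereal_inf_tmp => _ [u /= [u0 _] <-]; rewrite lee_fin.
Qed.

Lemma pressure_fekete u : 0 <= u -> exists P : R, [/\ pressure S u = P%:E,
  forall n, P * n%:R <= ln (partition_fun u n) &
  forall b, P < b -> exists2 n, (0 < n)%N & ln (partition_fun u n) < b * n%:R].
Proof.
move=> u0; have Zp n := partition_gt0 n u0.
have [m n|n|P [cP Ple Plt]] := @subadditive_cvg R (fun n => ln (partition_fun u n)) (- (u * ln c)).
- rewrite -lnM ?posrE//; rewrite ler_ln ?posrE ?mulr_gt0//; exact: partition_add.
- rewrite opprK; have : ln ((c ^+ n) `^ u) <= ln (partition_fun u n).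
    by rewrite ler_ln ?posrE ?powR_gt0 ?exprn_gt0//; exact: partition_ge.
  by rewrite ln_powR lnXn// -[ln _ *+ n]mulr_natr mulrA.
exists P; split => //.
have lg : log_growth S u = (fun n => (ln (partition_fun u n) / n%:R)%:E).
  by apply/funext => n; rewrite /log_growth Zsum_partition lne_EFin// -EFinM mulrC.
have cl : log_growth S u @ \oo --> P%:E.
  by rewrite lg; apply: continuous_cvg.
rewrite /pressure; case: asboolP => [_|]; first exact: cvg_lim cl.
case; split; last by apply/cvg_ex; exists P%:E.
rewrite theta_eq0; move: u0; rewrite le_eqVlt => /predU1P[u0|u0]; last by left; rewrite lte_fin.
by right; rewrite -u0; split => //; exists 0%N => // n _ /=; rewrite Zsum_partition ltry.
Qed.

Lemma pressure_exponent u t Pu Pt : 0 <= u -> u <= t ->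
  pressure S u = Pu%:E -> pressure S t = Pt%:E ->
  Pu + (t - u) * ln c <= Pt /\ Pt <= Pu + (t - u) * ln (ratio S).
Proof.
move=> u0 ut pu pt; have t0 := le_trans u0 ut.
have [Pu' [+ ule ult]] := pressure_fekete u0; rewrite pu => -[eu]; subst.
have [Pt' [+ tle tlt]] := pressure_fekete t0; rewrite pt => -[et]; subst.
have lnE (b : R) n : 0 < b -> ln ((b ^+ n) `^ (t - u) * partition_fun u n) =
    (t - u) * ln b * n%:R + ln (partition_fun u n).
  move=> b0; rewrite lnM ?posrE ?powR_gt0 ?exprn_gt0 ?partition_gt0//.
  by rewrite ln_powR lnXn// -[ln _ *+ n]mulr_natr mulrA.
split.
  apply/ler_addgt0Pr => e e_gt0.
  have [n n0 hn] := tlt (Pt' + e) ltac:(by rewrite ltrDl).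
  have n0' : 0 < n%:R :> R by rewrite ltr0n.
  rewrite -(ler_pM2r n0'); have [h _] := partition_exponent n ut; move: h.
  rewrite -ler_ln ?posrE ?mulr_gt0 ?powR_gt0 ?exprn_gt0 ?partition_gt0// lnE//.
  by have := ule n; lra.
apply/ler_addgt0Pr => e e_gt0.
have [n n0 hn] := ult (Pu' + e) ltac:(by rewrite ltrDl).
have n0' : 0 < n%:R :> R by rewrite ltr0n.
rewrite -(ler_pM2r n0'); have [_] := partition_exponent n ut.
rewrite -ler_ln ?posrE ?mulr_gt0 ?powR_gt0 ?exprn_gt0 ?partition_gt0// lnE//.
by have := tle n; lra.
Qed.

Lemma pressure0_ge0 (P : R) : pressure S 0 = P%:E -> 0 <= P.
Proof.
have [P' [-> _ Plt]] := pressure_fekete (lexx 0); move=> [<-]; rewrite leNgt; apply/negP => P0.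
have [n n0] := Plt 0 P0; rewrite mul0r; apply/negP; rewrite -leNgt; apply: ln_ge0.
by apply: le_trans (partition_ge n (lexx 0)); rewrite powRr0.
Qed.

(** If [partition_fun u n < 1], submultiplicativity makes [partition_fun u (k * n)]
    tend to zero; up to a constant it bounds the weight of the cover of the limit set
    by the images of the admissible words of length [k * n]. *)
Lemma pressure_lt0_null u (P : R) : 0 <= u -> pressure S u = P%:E -> P < 0 ->
  hausdorff_null union_dist u (limit_set S [set: E]).
Proof.
move=> u0; have [P' [-> _ Plt]] := pressure_fekete u0; move=> [<-] P0.
have [n n0] := Plt 0 P0; rewrite mul0r => lnZ.
have Zp := partition_gt0 n u0.
have Z1 : partition_fun u n < 1.
  by rewrite ltNge; apply/negP => /ln_ge0; rewrite leNgt lnZ.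
have [D D0 hD] := N_diameter.
have Zk k : partition_fun u (k * n) <= partition_fun u n ^+ k.
  elim: k => [|k IH]; first by rewrite mul0n /partition_fun sum_words0 weight_nil.
  rewrite mulSn exprS; apply: le_trans (partition_add _ _ u0) _.
  by apply: ler_wpM2l => //; exact: ltW.
have sk k : (0 < k)%N -> ratio S ^+ (k * n) <= ratio S ^+ k.
  by move=> k0; apply: ler_wiXn2l; rewrite ?ltW// leq_pmulr.
apply: (@hausdorff_null_finite_cover _ _ _ (seq E)) => delta eps delta0 eps0.
have small (q b : R) : 0 < q -> q < 1 -> 0 < b -> \forall k \near \oo, q ^+ k < b.
  move=> q0 q1 b0; have q1' : `|q| < 1 by rewrite gtr0_norm.
  have /cvgrPdist_lt /(_ b b0) := cvg_expr q1'.
  by apply: filterS => k; rewrite distrC subr0 ger0_norm// exprn_ge0// ltW.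
have [k [k0 kd ke]] : exists k, [/\ (0 < k)%N, ratio S ^+ k < delta / D &
    partition_fun u n ^+ k < eps / D `^ u].
  have h1 := small _ _ s0 s1 (divr_gt0 delta0 D0).
  have h2 := small _ _ Zp Z1 (divr_gt0 eps0 (powR_gt0 u D0)).
  have h3 : \forall k \near \oo, (0 < k)%N by exists 1%N.
  have [k _ hk] := filterI h1 (filterI h2 h3); exists k.
  by have [? [? ?]] := hk k (leqnn k).
set m := (k * n)%N in Zk sk; have m0 : (0 < m)%N by rewrite muln_gt0 k0 n0.
pose cyl w := [set p : V * 'rV[R]_d | p.1 = src S (head e0 w) /\
  exists2 x, word_dom S w x & p.2 = word_map S w x].
pose ws := [seq w <- words es m | sorted (incid S) w].
have cyl_diam w : w \in ws -> (diameter union_dist (cyl w) <= (D * N w)%:E)%E.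
  rewrite mem_filter => /andP[sw /size_words wm]; apply: diameter_le.
  move=> p q [p1 [x Xx p2]] [q1 [y Xy q2]]; rewrite lee_fin /union_dist p1 q1 eqxx addr0 p2 q2.
  by apply: hD sw _ Xy Xx; rewrite -size_eq0 wm -lt0n.
have wsN w : w \in ws -> 0 < N w.
  by rewrite mem_filter => /andP[sw _]; exact: N_gt0.
exists ws, cyl; split.
- move=> _ [omega [adm _] <-]; exists (mkseq omega m).
    rewrite mem_filter sorted_prefix//.
    by rewrite mem_words size_mkseq eqxx; apply/allP => e _; exact: mem_es.
  have mE : m = m.-1.+1 by rewrite prednK.
  split; first by rewrite mE.
  have [x Xx xE] := coding_mem confS m.-1 adm; exists x; rewrite mE ?xE//.
  by rewrite mkseqS word_dom_rcons.
- move=> w ww; apply: le_trans (cyl_diam w ww) _.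
  rewrite lee_fin mulrC -ler_pdivlMr//; move: ww; rewrite mem_filter => /andP[sw /size_words wm].
  apply: le_trans (ltW kd); apply: le_trans (sk k k0).
  by rewrite -/m -wm; exact: N_le.
apply: (@le_trans _ _ (\sum_(w <- ws) (D `^ u * N w `^ u)%:E)%E).
  rewrite big_seq [leRHS]big_seq; apply: lee_sum => w ww.
  have N0 := ltW (wsN w ww).
  rewrite -(powRM _ (ltW D0) N0); apply: (hausdorff_weight_le union_dist_refl) => //.
    by apply: mulr_ge0 => //; exact: ltW.
  exact: cyl_diam.
rewrite sumEFin lee_fin -mulr_sumr mulrC -ler_pdivlMr ?powR_gt0//.
apply: le_trans (ltW ke); apply: le_trans (Zk k); rewrite -/m /partition_fun /ws big_filter big_mkcond.
exact: lexx.
Qed.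

(** Mass distribution principle: each set of a cover meets boundedly many images of
    words stopped at its scale, each of mass at most the [u]-th power of the scale, so
    that a cover of small total weight cannot stop every infinite word. *)
Lemma pressure_gt0_not_null u (P : R) : 0 < u -> pressure S u = P%:E -> 0 < P ->
  ~ hausdorff_null union_dist u (limit_set S [set: E]).
Proof.
move=> u_gt0; have u0 := ltW u_gt0.
have [P' [-> Ple _]] := pressure_fekete u0; move=> [<-] {P} P0 null.
have Zp n := partition_gt0 n u0.
have Zub b : exists n, b < partition_fun u n.
  exists (Num.truncn (`|b| / P')).+1; set n := _.+1.
  have bn : `|b| < P' * n%:R.
    by rewrite mulrC -ltr_pdivrMr//; have /andP[] := truncn_itv (divr_ge0 (normr_ge0 b) (ltW P0)).
  apply: le_lt_trans (ler_norm b) _; apply: lt_le_trans bn _.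
  apply: le_trans (Ple n) _; have := le_ln1Dx (x := partition_fun u n - 1).
  by rewrite [X in ln X]addrC subrK; have := Zp n; lra.
have [m [m_nil m_le m_add]] := submultiplicative_mass (weight_ge0 u) (weight_nil u)
  (fun v w => weight_cat v w u0) Zub.
have [M hM] := stopped_multiplicity confS d_gt0 c_gt0 K_ge1 emap_ge distortion finE.
pose eps : R := (2 * M.+1%:R)^-1.
have M1 : 0 < M.+1%:R :> R by rewrite ltr0n.
have eps_gt0 : 0 < eps by rewrite invr_gt0 mulr_gt0.
have eps_lt1 : eps < 1.
  have : 1 <= M.+1%:R :> R by rewrite ler1n.
  by move=> h; rewrite /eps invf_lt1; lra.
have [U [r [JU r0 Ur sum_r]]] := hausdorff_null_radii union_dist_refl u_gt0 eps_gt0 null.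
have r_lt1 k : r k < 1.
  rewrite ltNge; apply/negP => rk1.
  have : ((r k `^ u)%:E <= eps%:E)%E.
    apply: le_trans sum_r; rewrite nneseries_esumT => [|i]; last by rewrite lee_fin powR_ge0.
    by apply: esum_ge; exists [set k]; rewrite ?fsbig_set1//; split => // _ ->.
  rewrite lee_fin leNgt (lt_le_trans eps_lt1)//.
  have h1 : 1 `^ u = 1 :> R by rewrite powR1.
  by rewrite -[leLHS]h1; apply: ge0_ler_powR; rewrite ?nnegrE ?ler01 ?(ltW (r0 k)).
pose G k := [set w | stopped S (r k) w /\ exists p, [/\ U k p,
  forall e v, w = e :: v -> src S e = p.1 &
  exists2 q, word_dom S w q & word_map S w q = p.2]].
have G_mass k : (\esum_(w in G k) (m w)%:E <= (M%:R * r k `^ u)%:E)%E.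
  apply: esum_le_card => [|w [[w' [e [_ sw Nr _]]] _]|s us sG]; first exact: powR_ge0.
    have /andP[_ mw] := m_le w; rewrite lee_fin; apply: le_trans mw _.
    rewrite /weight sw; rewrite NE in Nr; apply: ge0_ler_powR => //.
      by rewrite nnegrE; exact: ltW (N_gt0 sw).
    by rewrite nnegrE ltW.
  case: s us sG => // w0 s us sG; have [_ [p0 [Up0 _ _]]] := sG w0 (mem_head _ _).
  rewrite -[size _]card_ord.
  apply: (hM (r k) p0.1 p0.2 'I_(size (w0 :: s))
    (fun i => nth [::] (w0 :: s) i : seq E) (r0 k)) => [i j eq|i].
    apply/val_inj/eqP.
    by rewrite -[_ == _](nth_uniq [::] (ltn_ord i) (ltn_ord j) us) eq.
  have [st [p [Up src_p [q Xq qp]]]] := sG _ (mem_nth [::] (ltn_ord i)).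
  have near := Ur k _ _ Up Up0; have pp0 := union_dist_lt1 (le_lt_trans near (r_lt1 k)).
  split => // [e v /src_p ->//|]; exists q => //; rewrite qp.
  exact: le_trans (enorm_le_union_dist p p0) near.
have big : (1 <= \esum_(w in \bigcup_k G k) (m w)%:E)%E.
  apply: (stopped_mass_ge1 es_uniq m_nil) => // [w|omega m_pos]; first by have /andP[] := m_le w.
  have so n : sorted (incid S) (mkseq omega n).
    have /andP[_ mw] := m_le (mkseq omega n); have := lt_le_trans (m_pos n) mw.
    by rewrite /weight; case: ifP => //; rewrite ltxx.
  have adm : inf_admissible S omega.
    move=> n; have /(sortedP (omega 0%N)) := so n.+2; move=> /(_ n).
    by rewrite size_mkseq !nth_mkseq//; apply.
  have [k _ Uk] : (\bigcup_k U k) (coding_map S omega) by apply: JU; exists omega.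
  have stop_ex : exists n, N (mkseq omega n) <= r k.
    have s1' : `|ratio S| < 1 by rewrite gtr0_norm.
    have /cvgrPdist_lt /(_ (r k) (r0 k))[n _ hn] := cvg_expr s1'.
    exists n; apply: le_trans (N_le (so n)) _; rewrite size_mkseq.
    have := hn n (leqnn n); rewrite /= distrC subr0 ger0_norm; first exact: ltW.
    by rewrite exprn_ge0// ltW.
  case: (ex_minnP stop_ex) => -[|n] Nn n_min.
    by exfalso; move: Nn; rewrite /= N_nil leNgt r_lt1.
  exists n.+1, k => //; split.
    exists (mkseq omega n), (omega n); rewrite -mkseqS !NE; split => //.
    by rewrite ltNge; apply/negP => /n_min; rewrite ltnn.
  exists (coding_map S omega); split => // [e v /= [-> _]//|].
  have [q Xq qE] := coding_mem confS n adm; exists q => //.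
  by rewrite mkseqS word_dom_rcons.
have sum_le : (\sum_(0 <= k <oo) \esum_(w in G k) (m w)%:E <= (M%:R * eps)%:E)%E.
  apply: (@le_trans _ _ (\sum_(0 <= k <oo) (M%:R%:E * (r k `^ u)%:E))%E).
    apply: lee_nneseries => [k _ _|k _]; last by rewrite -EFinM; exact: G_mass.
    by apply: esum_ge0 => w _; have /andP[] := m_le w; rewrite lee_fin.
  rewrite nneseriesZl => [|k _]; last by rewrite lee_fin powR_ge0.
  by rewrite EFinM; apply: lee_wpmul2l => //; rewrite lee_fin.
have m_ge0 w : (0 <= (m w)%:E)%E by have /andP[] := m_le w; rewrite lee_fin.
have := le_trans (le_trans big (esum_bigcup_le G m_ge0)) sum_le.
rewrite lee_fin leNgt => /negP; apply.
rewrite /eps -ltr_pdivlMr ?invr_gt0 ?mulr_gt0// div1r invrK -natr1.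
by have : 0 <= M%:R :> R by []; lra.
Qed.

End partition_function.

(** What locates the dimension: the slopes of the pressure lie between [b] and
    [ln (ratio S) < 0], and its sign decides whether Hausdorff measure vanishes. *)
Lemma pressure_properties (R : realType) (d : nat) (V : finType) (E : countType)
    (S : gdms R d V E) : conformal S -> finite_set [set: E] -> [set: E] !=set0 ->
  exists (P : R -> R) (b : R), [/\
    forall u, 0 <= u -> pressure S u = (P u)%:E,
    0 <= P 0,
    forall u t, 0 <= u -> u <= t ->
      P u + (t - u) * b <= P t /\ P t <= P u + (t - u) * ln (ratio S),
    forall u, 0 <= u -> P u < 0 -> hausdorff_null union_dist u (limit_set S [set: E]) &
    forall u, 0 < u -> 0 < P u -> ~ hausdorff_null union_dist u (limit_set S [set: E])].
Proof.
move=> confS finE nE; have d_gt0 := conformal_dim_gt0 confS nE.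
have [c c_gt0 emap_ge] := opnorm_emap_ge confS finE.
have [K K_ge1 distortion] := bounded_distortion confS d_gt0 finE.
have [es es_uniq Ees] := finite_uniq_seq finE.
have mem_es e : e \in es by have := I : [set: E] e; rewrite Ees.
have [e0 _] := nE; have NE w : dnorm_sup S w = dnorm_sup S w := erefl.
have /choice[P hP] u : exists p : R, 0 <= u -> pressure S u = p%:E.
  have [u0|/negP u0] := boolP (0 <= u); last by exists 0.
  have [p [pE _ _]] := pressure_fekete confS d_gt0 c_gt0 emap_ge e0 NE es_uniq mem_es u0.
  by exists p.
exists P, (ln c); split.
- exact: hP.
- exact: (pressure0_ge0 confS d_gt0 c_gt0 emap_ge e0 NE es_uniq mem_es (hP 0 (lexx 0))).
- move=> u t u0 ut.
  exact: (pressure_exponent confS d_gt0 c_gt0 emap_ge e0 NE es_uniq mem_es u0 ut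
    (hP u u0) (hP t (le_trans u0 ut))).
- move=> u u0; exact: (pressure_lt0_null confS d_gt0 finE c_gt0 emap_ge e0 NE
    es_uniq mem_es u0 (hP u u0)).
- move=> u u0; exact: (pressure_gt0_not_null confS d_gt0 finE c_gt0 K_ge1 emap_ge
    distortion e0 NE es_uniq mem_es u0 (hP u (ltW u0))).
Qed.

Lemma HD_limit_set_pressure (R : realType) (d : nat) (V : finType) (E : countType)
    (S : gdms R d V E) : conformal S -> finite_set [set: E] -> [set: E] !=set0 ->
  exists2 h : R, HD (limit_set S [set: E]) = h%:E &
    pressure S h = 0%E /\ forall u : R, 0 <= u -> pressure S u = 0%E -> u = h.
Proof.
move=> confS finE nE; set J := limit_set S [set: E].
have [P [b [hP P0 slope neg pos]]] := pressure_properties confS finE nE.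
have l0 : ln (ratio S) < 0 by apply: ln_lt0; rewrite ratio_gt0 ratio_lt1.
have ge0 : (0 <= HD J)%E by exact: hausdorff_dim_ge0.
have upper u : 0 <= u -> P u < 0 -> (HD J <= u%:E)%E.
  by move=> u0 Pu; apply: hausdorff_dim_le => //; exact: neg.
have lower u : 0 < u -> 0 < P u -> (u%:E <= HD J)%E.
  by move=> u0 Pu; apply: (hausdorff_dim_ge union_dist_refl); exact: pos.
have [h hE] : exists h : R, HD J = h%:E.
  pose u := (P 0 + 1) / - ln (ratio S).
  have u0 : 0 <= u by rewrite divr_ge0 ?addr_ge0// oppr_ge0 ltW.
  have ul : u * ln (ratio S) = - (P 0 + 1) by rewrite /u; field; rewrite lt_eqF.
  have : (HD J <= u%:E)%E.
    by apply: upper => //; have [_] := slope 0 u (lexx 0) u0; rewrite subr0 ul; lra.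
  by move: ge0; case: (HD J) => // r _ _; exists r.
exists h => //; rewrite hE in ge0 upper lower; rewrite lee_fin in ge0.
have strict u t : 0 <= u -> u < t -> P t < P u.
  move=> u0 ut; have [_ le] := slope u t u0 (ltW ut); apply: le_lt_trans le _.
  by rewrite gtrDl pmulr_rlt0// subr_gt0.
have b1 : 0 < `|b| + 1 by rewrite ltr_wpDl.
have Ph : P h = 0.
  apply/eqP; rewrite eq_le; apply/andP; split; rewrite leNgt; apply/negP => Ph.
    (* the pressure stays positive slightly to the right of [h] *)
    pose e := P h / (`|b| + 1) / 2; have e0 : 0 < e by rewrite !divr_gt0.
    have [le _] := slope h (h + e) ge0 ltac:(by rewrite lerDl ltW).
    have eb : - (P h / 2) < e * b.
      have -> : P h / 2 = e * (`|b| + 1) by rewrite /e; field; rewrite gt_eqF.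
      by rewrite -mulrN ltr_pM2l//; have := ler_norm (- b); rewrite normrN; lra.
    have Phe : 0 < P (h + e) by move: le; rewrite (_ : h + e - h = e); [lra|ring].
    by have := lower (h + e) ltac:(lra) Phe; rewrite lee_fin; lra.
  (* the pressure stays negative slightly to the left of [h] *)
  have h0 : 0 < h.
    rewrite lt_neqAle ge0 andbT; apply/eqP => h0; rewrite -h0 in Ph.
    by have := lt_le_trans Ph P0; rewrite ltxx.
  pose e := Num.min h (- P h / (`|b| + 1) / 2).
  have e0 : 0 < e by rewrite lt_min h0 !divr_gt0// oppr_gt0.
  have eh : e <= h by rewrite ge_min lexx.
  have eP : e * (`|b| + 1) <= - P h / 2.
    have : e <= - P h / (`|b| + 1) / 2 by rewrite ge_min lexx orbT.
    by rewrite mulrAC ler_pdivlMr.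
  have [le _] := slope (h - e) h ltac:(lra) ltac:(lra).
  have Phe : P (h - e) < 0.
    have : e * - b <= e * `|b| by rewrite ler_pM2l// -normrN ler_norm.
    by move: le; rewrite (_ : h - (h - e) = e); [lra|ring].
  by have := upper (h - e) ltac:(lra) Phe; rewrite lee_fin; lra.
split; first by rewrite hP// Ph.
move=> u u0; rewrite hP// => -[Pu]; apply/eqP; case: ltgtP => // [uh|hu].
  by have := strict _ _ u0 uh; rewrite Ph Pu ltxx.
by have := strict _ _ ge0 hu; rewrite Ph Pu ltxx.
Qed.

Theorem theorem4p1 (R : realType) (d : nat) (V : finType) (E : countType)
    (S : gdms R d V E) (confS : conformal S) (finE : finite_set [set: E]) :
  is_max [set HD (limit_set S C) | C in [set C | strongly_connected_component S C]]
         (HD (limit_set S [set: E]))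
  /\
  ([set: E] !=set0 ->
   [/\ HD (limit_set S [set: E]) \is a fin_num,
       pressure S (fine (HD (limit_set S [set: E]))) = 0%E &
       forall u : R, 0 <= u -> pressure S u = 0%E ->
         u = fine (HD (limit_set S [set: E]))]).
Proof.
split; first exact: HD_limit_set_components.
move=> nE; have [h hE [Ph uniq_h]] := HD_limit_set_pressure confS finE nE.
by rewrite hE.
Qed.
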